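(* Let $d\geq 3$, let $\Gamma$ be a cocompact lattice in $G = \mathrm{Aut}(T_d)$, where $T_d$ is the $d$-regular tree, and let $C = \mathrm{Comm}_G(\Gamma)$. Then the group $C/\!\!/\Gamma$ admits an open normal subgroup such that the associated quotient is a free abelian group of infinite rank. In particular $C/\!\!/\Gamma$ is not virtually topologically simple.
   Context: $\mathrm{Aut}(T_d)$ carries the topology of pointwise convergence on vertices. Two subgroups of a group are commensurable if their intersection has finite index in each of them. For a discrete subgroup $\Gamma$ of a locally compact group $G$, $\mathrm{Comm}_G(\Gamma)$ is the subgroup of all $g\in G$ such that $\Gamma$ and $g\Gamma g^{-1}$ are commensurable. For a group $C$ and a subgroup $\Gamma \le C$ such that $\Gamma$ and $c\Gamma c^{-1}$ are commensurable for all $c \in C$, the completion $C/\!\!/\Gamma$ of $C$ with respect to $\Gamma$ (also called the relative profinite or Schlichting completion) is the closure of the image of $C$ in the group $\mathrm{Sym}(C/\Gamma)$ of permutations of the coset space $C/\Gamma$, for the topology of pointwise convergence, where $C$ acts on $C/\Gamma$ by left translation. It is a totally disconnected locally compact group, the image of $C$ is dense in it, and the closure of the image of $\Gamma$ is a compact open subgroup. A topological group is topologically simple if it has no closed normal subgroups other than itself and the trivial subgroup; it is virtually topologically simple if it has a closed finite index subgroup that is topologically simple. *)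

(* Defs.v *)
From HB Require Import structures.
From mathcomp Require Import all_boot all_order all_algebra.
From mathcomp Require Import all_classical topology.
From mathcomp.multinomials Require Import freeg.

Set Implicit Arguments.
Unset Strict Implicit.
Unset Printing Implicit Defensive.

Local Open Scope classical_set_scope.
Local Open Scope group_scope.

(* A subgroup is a set H : set G satisfying is_subgroup; when G is a
   topological group, H carries the subspace topology. *)
Section Subgroups.
Variable G : groupType.
Implicit Types (x g : G) (A B H K N : set G).

Definition is_subgroup H : Prop :=
  [/\ H 1, forall x y, H x -> H y -> H (x * y) & forall x, H x -> H x^-1].

Definition set_mul A B : set G := [set x * y | x in A & y in B].

Definition left_coset x K : set G := [set x * y | y in K].

Definition left_cosets H K : set (set G) := [set left_coset x K | x in H].

Definition conj_set g A : set G := [set g * x * g^-1 | x in A].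

Definition normal_subgroup N H : Prop :=
  [/\ is_subgroup N, N `<=` H & forall h, H h -> conj_set h N = N].

Definition finite_index K H : Prop := finite_set (left_cosets H K).

Definition commensurable A B : Prop :=
  finite_index (A `&` B) A /\ finite_index (A `&` B) B.

Definition commensurator H K : set G :=
  [set g | H g /\ commensurable K (conj_set g K)].

(* For N normal in H, the group H/N is the set left_cosets H N under set_mul;
   {freeg I} is the free abelian group on I, written additively. *)
Definition quotient_free_abelian_infinite_rank H N : Prop :=
  exists (I : choiceType) (f : set G -> {freeg I}),
    [/\ infinite_set [set: I],
        set_bij (left_cosets H N) [set: {freeg I}] f &
        forall A B, left_cosets H N A -> left_cosets H N B ->
          f (set_mul A B) = (f A + f B)%R].

End Subgroups.

HB.mixin Record isTopologicalGroup G & Group G & Topological G := {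
  mulg_continuous : continuous (fun x : G * G => x.1 * x.2);
  invg_continuous : continuous (fun x : G => x^-1);
}.

#[short(type="topologicalGroupType")]
HB.structure Definition TopologicalGroup :=
  {G of isTopologicalGroup G & Group G & Topological G}.

Definition coset_space (G : groupType) (H K : set G) : Type :=
  set_type (left_cosets H K).

HB.instance Definition _ (G : groupType) (H K : set G) :=
  Choice.copy (coset_space H K) (set_type (left_cosets H K)).

Definition coset_proj (G : groupType) (H K : set G) (h : set_type H) :
  coset_space H K :=
  exist _ (left_coset (set_val h) K)
    (mem_set (imageP (fun x => left_coset x K) (set_valP h))).
Arguments coset_proj {G} H K h.

(* The quotient topology on H/K. *)
Section CosetSpaceTopology.
Variables (G : topologicalGroupType) (H K : set G).

Definition coset_open (U : set (coset_space H K)) : Prop :=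
  open (coset_proj H K @^-1` U).

Lemma coset_openT : coset_open setT.
Proof. by rewrite /coset_open preimage_setT; exact: openT. Qed.

Lemma coset_openI : setI_closed coset_open.
Proof. by move=> A B oA oB; rewrite /coset_open preimage_setI; exact: openI. Qed.

Lemma coset_open_bigU (I : Type) (f : I -> set (coset_space H K)) :
  (forall i, coset_open (f i)) -> coset_open (\bigcup_i f i).
Proof.
move=> fo; rewrite /coset_open preimage_bigcup.
by apply: bigcup_open => i _; exact: fo.
Qed.

HB.instance Definition _ := isOpenTopological.Build (coset_space H K)
  coset_openT coset_openI coset_open_bigU.

End CosetSpaceTopology.

Section TopologicalGroups.
Variable G : topologicalGroupType.
Implicit Types (H K N : set G).

Definition open_in H N : Prop := open (N : set (subspace H)).

Definition closed_in H N : Prop := closed (N : set (subspace H)).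

Definition discrete_subgroup K H : Prop :=
  [/\ is_subgroup K, K `<=` H & isolated K = K].

Definition cocompact_lattice K H : Prop :=
  discrete_subgroup K H /\ compact [set: coset_space H K].

Definition topologically_simple H : Prop :=
  forall N, normal_subgroup N H -> closed_in H N -> N = [set 1] \/ N = H.

Definition virtually_topologically_simple H : Prop :=
  exists K, [/\ is_subgroup K, K `<=` H, closed_in H K, finite_index K H &
    topologically_simple K].

End TopologicalGroups.

(* The group of all permutations of X, with (s * t) x = s (t x). *)
Record Sym (X : choiceType) :=
  MkSym { sym_fun :> X -> X; sym_bij : bijective sym_fun }.

Section SymGroup.
Variable X : choiceType.
Implicit Types s t : Sym X.

Lemma sym_inj s t : s =1 t -> s = t.
Proof.
case: s t => [f fb] [g gb] /= /funext fg; subst g.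
by congr MkSym; exact: Prop_irrelevance.
Qed.

HB.instance Definition _ := gen_eqMixin (Sym X).
HB.instance Definition _ := gen_choiceMixin (Sym X).

Definition sym_one : Sym X := MkSym (@Bijective X X id id (fun=> erefl) (fun=> erefl)).

Definition sym_mul s t : Sym X := MkSym (bij_comp (sym_bij s) (sym_bij t)).

Lemma sym_inv_subproof s : exists t, cancel s t /\ cancel t s.
Proof.
case: (sym_bij s) => g sK gK.
by exists (MkSym (Bijective gK sK)).
Qed.

Definition sym_inv s : Sym X := projT1 (cid (sym_inv_subproof s)).

Lemma sym_invK s : cancel s (sym_inv s) /\ cancel (sym_inv s) s.
Proof. exact: projT2 (cid (sym_inv_subproof s)). Qed.

Lemma sym_mulA : associative sym_mul.
Proof. by move=> r s t; exact: sym_inj. Qed.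
Lemma sym_mul1g : left_id sym_one sym_mul.
Proof. by move=> s; exact: sym_inj. Qed.
Lemma sym_mulg1 : right_id sym_one sym_mul.
Proof. by move=> s; exact: sym_inj. Qed.
Lemma sym_mulVg : left_inverse sym_one sym_inv sym_mul.
Proof. by move=> s; apply: sym_inj => x; exact: (sym_invK s).1. Qed.
Lemma sym_mulgV : right_inverse sym_one sym_inv sym_mul.
Proof. by move=> s; apply: sym_inj => x; exact: (sym_invK s).2. Qed.

HB.instance Definition _ := isGroup.Build (Sym X)
  sym_mulA sym_mul1g sym_mulg1 sym_mulVg sym_mulgV.

(* The topology of pointwise convergence, X being discrete. *)
HB.instance Definition _ := Topological.copy (Sym X)
  (initial_topology
    (fun s => (s : X -> X) : {ptws X -> discrete_topology X})).

Lemma sym_cvgP (F : set_system (Sym X)) s : Filter F ->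
  F --> s <-> forall x, F [set t : Sym X | t x = s x].
Proof.
move=> FF; split=> [Fs x|Fs].
  apply: Fs.
  pose ev := fun f : {ptws X -> discrete_topology X} => f x.
  have oS : open (ev @^-1` [set s x]).
    apply: open_comp; last exact: discrete_open.
    by move=> f _; exact: (@proj_continuous X (fun=> discrete_topology X) x f).
  exists [set t : Sym X | t x = s x]; split=> //.
  by exists (ev @^-1` [set s x]).
move=> U [_ [[B oB <-] /= Bs sBU]].
pose G := (fun t => (t : X -> X) : {ptws X -> discrete_topology X}) @ F.
have FG : Filter G by exact: fmap_filter.
have Gs : G --> ((s : X -> X) : {ptws X -> discrete_topology X}).
  apply/cvg_sup => x W [_ [[D oD <-] /= Ds sDW]].
  apply: (filterS sDW); rewrite /G nbhs_simpl /=.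
  by apply: filterS (Fs x) => t /= ->.
apply: (filterS sBU); apply: Gs.
by apply: open_nbhs_nbhs; split.
Qed.

Lemma sym_near s x : nbhs s [set t : Sym X | t x = s x].
Proof. by have /sym_cvgP := @cvg_id _ (nbhs s); apply. Qed.

Lemma sym_mulg_continuous : continuous (fun p : Sym X * Sym X => p.1 * p.2).
Proof.
move=> [s t]; apply/sym_cvgP => x /=.
exists ([set s' : Sym X | s' (t x) = s (t x)], [set t' : Sym X | t' x = t x]).
  by split; exact: sym_near.
by move=> [s' t'] /= [sE tE]; rewrite /= tE sE.
Qed.

Lemma sym_invg_continuous : continuous (fun s : Sym X => s^-1).
Proof.
move=> s; apply/(@sym_cvgP _ _ (fmap_filter _ (nbhs_filter s))) => x /=.
apply: (@filterS _ (nbhs s) _ _ _ _ (sym_near s (sym_inv s x))) => t /= tE.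
have sK : s (s^-1 x) = x by exact: (sym_invK s).2.
by rewrite -[in LHS]sK -tE; exact: (sym_invK t).1.
Qed.

HB.instance Definition _ := isTopologicalGroup.Build (Sym X)
  sym_mulg_continuous sym_invg_continuous.

End SymGroup.

(* The completion C//K: C acts on C/K by left translation, and the closure is
   taken in the group of permutations of C/K. *)
Section Completion.
Variables (G : groupType) (C K : set G).

Definition left_translations : set (Sym (coset_space C K)) :=
  [set s : Sym (coset_space C K) | exists2 c, C c &
    forall A : coset_space C K, set_val (s A) = left_coset c (set_val A)].

Definition completion : set (Sym (coset_space C K)) :=
  closure left_translations.

End Completion.
Arguments left_translations {G} C K _.
Arguments completion {G} C K _.

Section Trees.
Variables (V : choiceType) (e : rel V).

Definition is_tree : Prop :=
  [/\ inhabited V, symmetric e, irreflexive e,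
      forall x y, exists2 p, path e x p & last x p = y &
      forall c, ucycle e c -> size c <= 2].

(* The d-regular tree T_d; it is unique up to isomorphism. *)
Definition is_regular_tree (d : nat) : Prop :=
  is_tree /\ forall x, ([set y | e x y] #= `I_d)%card.

Definition graph_aut : set (Sym V) :=
  [set g : Sym V | forall x y, e (g x) (g y) = e x y].

End Trees.

(* Main.v *)
From mathcomp Require Import all_boot all_fingroup all_algebra all_solvable zify.
From mathcomp Require Import finmap.
Require Import Defs.
From HB Require Import structures.
From mathcomp Require Import all_boot all_order all_algebra.
From mathcomp Require Import all_classical topology.
From mathcomp.multinomials Require Import freeg.

Set Implicit Arguments.
Unset Strict Implicit.
Unset Printing Implicit Defensive.

Import Order.TTheory GRing.Theory.
Local Open Scope classical_set_scope.

(** The number of composition factors of order p of a finite group is additive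
    in extensions, so it refines the index of a subgroup: when B has finite
    index in A, map A to a finite group with kernel inside B, and subtract the
    number for the image of B from the number for the image of A. By additivity
    the result does not depend on the finite group; it adds up along chains of
    subgroups and is invariant under conjugation (refined_index). Comparing two
    commensurable groups through their intersection gives an additive cocycle,
    and g |-> gap between Gamma and its conjugate by g is a homomorphism from
    the commensurator C to the integers that vanishes on Gamma: displacement.
    The displacement of a given g is zero at all large primes, so the
    displacements at the primes p > 4 form one homomorphism from C to the free
    abelian group on these primes.

    It is surjective. Gamma is commensurable to the group W of automorphisms of
    the tree that preserve some legal colouring of the edges with d colours
    (lattice_commensurable_colour_group, Leighton's theorem). W is a free
    product of d groups of order two acting simply transitively on the
    vertices, so d involutions of a finite set Y with a base point define an
    action of W on Y, hence a subgroup of finite index, the stabiliser of the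
    base point. If the action is transitive, the quotient of the tree by this
    subgroup is the graph on Y drawn by the involutions. Colouring the edges of the same graph in another
    way gives other involutions and another subgroup, and the universal cover
    of the identity of the graph is an automorphism of the tree that conjugates
    one subgroup to the other (recolouring_conjugates). Take for the graph a
    path with p vertices, completed by half-edges. When the colours of the path
    alternate, the involutions generate a dihedral group of order 2p, with one
    composition factor of order p; when its first edge gets a third colour,
    they generate the symmetric group, which has none because the alternating
    group is simple. Point stabilisers have order prime to p in both cases.
    This produces an element of C with displacement -1 at p and 0 at the primes
    above p, since these do not divide p! (prime_displacement), and the
    resulting triangular matrix yields surjectivity.

    A homomorphism from C that vanishes on Gamma extends to the completion: an
    element of the completion moves the coset Gamma to some c Gamma, and the
    image of c is the value. The kernel is open, and it is the subgroup
    announced. If K were a topologically simple subgroup of finite index, the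
    elements of K of displacement 0 at 7 would form a closed normal subgroup of
    K, different from K and from 1 because K contains powers of elements whose
    displacements at 5 and 7 are prescribed.

    The constructions on the tree are all instances of one remark. Attach a set
    to each vertex and a bijection to each edge: since the tree has no circuit,
    every element of the set at one vertex extends to a unique section
    (section_exists, section_unique). Isomorphisms of coloured trees,
    permutation representations of W, colourings, and the equivariant data of
    Leighton's theorem are sections, and a group acting on the tree and on the
    attached sets permutes the sections, with stabilisers of finite index when
    these sets are finite (finite_index_section_stabiliser). *)

(** * Composition factors of order p *)

Section FiniteCount.
Import boot.fintype boot.bigop boot.finset fingroup.perm.
Local Open Scope set_scope.
Local Open Scope group_scope.

(** The number k counts the steps of index p in a subnormal series of G, whose
    other steps are arbitrary: a series need not be a composition series. *)
Inductive psteps (p : nat) (gT : finGroupType) : {group gT} -> nat -> Prop :=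
| psteps1 : psteps p 1%G 0
| pstepsS (G N : {group gT}) k :
    (N <| G)%g -> psteps p N k -> psteps p G (k + (#|G : N| == p)).

Lemma psteps_dvdn p gT (G : {group gT}) k : psteps p G k -> (p ^ k %| #|G|)%N.
Proof.
elim=> [|{}G N {}k nNG _ IH]; first by rewrite dvd1n.
rewrite -(Lagrange (normal_sub nNG)) expnD; apply: dvdn_mul => //.
by case: eqP => [->|_]; rewrite ?expn1 ?dvdn1 ?dvd1n.
Qed.

Lemma psteps_exists p gT (G : {group gT}) : exists k, psteps p G k.
Proof.
exists (0 + (#|G : 1%G| == p))%N.
by apply: pstepsS; [exact: normal1|exact: psteps1].
Qed.

Lemma psteps_bound p gT (G : {group gT}) k :
  psteps p G k -> 1 < p -> (k <= #|G|)%N.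
Proof.
move=> sk p1; apply: ltnW; apply: (leq_trans (ltn_expl k p1)).
by apply: dvdn_leq; [exact: cardG_gt0|exact: psteps_dvdn].
Qed.

Lemma index_ker_morphim (aT rT : finGroupType) (D : {group aT})
    (f : {morphism D >-> rT}) (A B : {group aT}) :
  A \subset D -> B \subset A ->
  (#|A : B| = #|'ker_A f : 'ker_B f| * #|f @* A : f @* B|)%N.
Proof.
move=> AD BA; have BD := subset_trans BA AD.
have cA (E : {group aT}) : E \subset D -> (#|E| = #|'ker_E f| * #|f @* E|)%N.
  move=> ED; by rewrite card_morphim (setIidPr ED) LagrangeI.
apply/eqP; rewrite -(eqn_pmul2l (cardG_gt0 B)) Lagrange //.
rewrite (cA B BD) mulnACA !Lagrange ?morphimS // ?(cA A AD) //.
by rewrite setSI.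
Qed.

(** A series of Q induces series of the kernel and of the image, in which the
    index of each step of Q splits as a product; when the index is the prime p,
    one of the two factors is p. *)
Lemma psteps_split p (aT rT : finGroupType) (D : {group aT})
    (f : {morphism D >-> rT}) (Q : {group aT}) k :
  prime p -> psteps p Q k -> Q \subset D ->
  exists k1 k2, [/\ psteps p ('ker_Q f)%G k1, psteps p (f @* Q)%G k2 &
                    (k <= k1 + k2)%N].
Proof.
move=> pp; elim=> [_|{}Q N {}k nNQ _ IH QD].
  exists 0%N, 0%N; split => //.
  - suff -> : ('ker_1 f = 1)%G by exact: psteps1.
    by apply: val_inj; rewrite /= (setIidPl _) // sub1G.
  - suff -> : (f @* 1 = 1)%G by exact: psteps1.
    by apply: val_inj; rewrite /= morphim1.
have NQ := normal_sub nNQ.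
have [k1 [k2 [s1 s2 kE]]] := IH (subset_trans NQ QD).
exists (k1 + (#|'ker_Q f : 'ker_N f| == p))%N.
exists (k2 + (#|f @* Q : f @* N| == p))%N.
split.
- apply: (pstepsS _ s1); rewrite /=.
  rewrite /normal setSI //=.
  apply: subset_trans (subsetIl _ _) _; apply: normsI.
    exact: normal_norm.
  exact: subset_trans QD (ker_norm f).
- by apply: (pstepsS _ s2); rewrite /= morphim_normal.
- rewrite addnACA; apply: leq_add => //.
  rewrite (index_ker_morphim f QD NQ).
  (* a divisor of the prime p is 1 or p *)
  case: eqP => // ab; set a := #|_ : _| in ab *.
  have : (a %| p)%N by rewrite -ab dvdn_mulr.
  move/primeP: (pp) => [_ /[apply]] /orP[/eqP aE|/eqP ->]; last by rewrite eqxx.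
  by rewrite -ab aE mul1n eqxx addn1.
Qed.

(** Conversely a series of the kernel is continued by the preimages of a series
    of the image. *)
Lemma psteps_join p (aT rT : finGroupType) (D : {group aT})
    (f : {morphism D >-> rT}) (Q : {group aT}) k1 (H : {group rT}) k2 :
  Q \subset D -> psteps p ('ker_Q f)%G k1 ->
  psteps p H k2 -> H \subset f @* Q ->
  psteps p (Q :&: f @*^-1 H)%G (k1 + k2).
Proof.
move=> QD s1; elim=> [_|{}H N {}k2 nNH _ IH HQ].
  suff -> : (Q :&: f @*^-1 1 = 'ker_Q f)%G by rewrite addn0.
  by apply: val_inj; rewrite /= /ker.
have NH := normal_sub nNH.
have NQ := subset_trans NH HQ.
have imE (E : {group rT}) : E \subset f @* Q -> f @* (Q :&: f @*^-1 E) = E.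
  by move=> EQ; rewrite morphim_setIpre; apply/setIidPr.
have kerE (E : {group rT}) : 'ker_(Q :&: f @*^-1 E) f = 'ker_Q f.
  apply/setP => x; rewrite !inE.
  case: (x \in Q) => //=; case: (boolP (x \in D)) => //= xD; case: eqP => [->|]; rewrite ?andbF //.
  by rewrite group1.
rewrite addnA.
have -> : (#|H : N| = #|Q :&: f @*^-1 H : Q :&: f @*^-1 N|)%N.
  rewrite (@index_ker_morphim _ _ _ f (Q :&: f @*^-1 H)%G (Q :&: f @*^-1 N)%G) /=.
  - by rewrite !kerE !imE // indexgg mul1n.
  - exact: subset_trans (subsetIl _ _) QD.
  - by rewrite setIS // morphpreS.
apply: pstepsS (IH NQ); rewrite /= /normal setIS ?morphpreS //=.
apply: normsI; first by apply: subset_trans (subsetIl _ _) (normG _).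
apply: subset_trans (subsetIr _ _) _.
by apply: subset_trans (morphpre_norm _ _); rewrite morphpreS // normal_norm.
Qed.

(** The number of composition factors of order p. The maximum over all
    subnormal series is attained at the composition series, and taking it makes
    additivity a matter of two inequalities, without the theorem of Jordan and
    Hoelder. *)
Definition pfactors p (gT : finGroupType) (G : {group gT}) : nat :=
  \max_(k < #|G|.+1 | `[< psteps p G k >]) k.

Lemma pfactors_max p gT (G : {group gT}) k :
  prime p -> psteps p G k -> (k <= pfactors p G)%N.
Proof.
move=> pp sk; have kG := psteps_bound sk (prime_gt1 pp).
rewrite /pfactors.
by rewrite (bigmax_sup (Ordinal (n:=#|G|.+1) kG)) //; exact/asboolP.
Qed.

Lemma pfactors_steps p gT (G : {group gT}) : prime p -> psteps p G (pfactors p G).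
Proof.
move=> pp; have [k sk] := psteps_exists p G.
have kG := psteps_bound sk (prime_gt1 pp).
have := @eq_bigmax_cond _ [pred k : 'I_#|G|.+1 | `[< psteps p G k >]] (fun k => k : nat).
case.
  by apply/card_gt0P; exists (Ordinal (n:=#|G|.+1) kG); rewrite inE; exact/asboolP.
by move=> i; rewrite inE => /asboolP si; rewrite /pfactors => ->.
Qed.

(** Additivity in extensions, on which all that follows rests. *)
Lemma pfactors_morphim p (aT rT : finGroupType) (D : {group aT})
    (f : {morphism D >-> rT}) (Q : {group aT}) :
  prime p -> Q \subset D ->
  pfactors p Q = (pfactors p ('ker_Q f)%G + pfactors p (f @* Q)%G)%N.
Proof.
move=> pp QD; apply/eqP; rewrite eqn_leq; apply/andP; split.
  have [k1 [k2 [s1 s2 /leq_trans]]] := psteps_split f pp (pfactors_steps Q pp) QD.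
  by apply; rewrite leq_add // pfactors_max.
apply: pfactors_max => //.
have := psteps_join QD (pfactors_steps _ pp) (pfactors_steps (f @* Q)%G pp) (subxx _).
congr (psteps _ _ _); apply: val_inj => /=.
by apply/setIidPl; rewrite -sub_morphim_pre.
Qed.

Lemma pfactors_dvdn p gT (G : {group gT}) :
  prime p -> (p ^ pfactors p G %| #|G|)%N.
Proof. by move=> pp; apply: psteps_dvdn; exact: pfactors_steps. Qed.

Lemma pfactors_eq0 p gT (G : {group gT}) :
  prime p -> ~~ (p %| #|G|)%N -> pfactors p G = 0%N.
Proof.
move=> pp /negP pG; have := pfactors_dvdn G pp.
case: (pfactors p G) => // k pk; case: pG.
by apply: dvdn_trans pk; rewrite expnS dvdn_mulr.
Qed.

Lemma pfactors_simple p gT (G : {group gT}) :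
  prime p -> simple G -> #|G| <> p -> pfactors p G = 0%N.
Proof.
move=> pp /simpleP [_ sG] Gp.
have : psteps p G (pfactors p G) by exact: pfactors_steps.
suff H k (H : {group gT}) : psteps p H k -> H :=: G \/ H :=: 1 -> k = 0%N.
  by move/H; apply; left.
elim=> [//|{}H N {}k nNH _ IH HG].
have [NH|N1] : N :=: H \/ N :=: 1.
    case: HG => [HG|H1]; last first.
      by right; apply/trivgP; rewrite -H1 normal_sub.
    by have := sG N; rewrite -HG => /(_ nNH) [->|->]; [right|left].
  rewrite NH indexgg IH; last by rewrite NH.
  by case: eqP => // p1; move: pp; rewrite -p1.
rewrite N1 indexg1 IH; last by right.
case: eqP => // Hp; case: HG => [HG|H1]; first by case: Gp; rewrite -HG.
by move: pp; rewrite -Hp H1 cards1.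
Qed.

End FiniteCount.
(** * Dihedral and symmetric groups of prime degree *)

Lemma prime_dvdn_fact q m : prime q -> (q %| m`!)%N -> (q <= m)%N.
Proof.
move=> pq; elim: m => [|m IH]; first by rewrite dvdn1 => /eqP q1; move: pq; rewrite q1.
rewrite factS Euclid_dvdM // => /orP[/dvdn_leq->//|/IH/leqW //].
Qed.

Section DihedralSymmetric.
Import boot.fintype boot.bigop boot.finset fingroup.perm.
Local Open Scope set_scope.
Variable n : nat.
Local Notation T := 'I_n.+2.
Local Notation p := n.+2.
Hypothesis n_prime : prime p.

Lemma reflection_inj (c : T) : injective (fun x : T => (c - x)%R).
Proof. by move=> x y /= /GRing.addrI /GRing.oppr_inj. Qed.

Definition reflection (c : T) : {perm T} := perm (@reflection_inj c).

Definition shift : {perm T} := perm (GRing.addrI (1%R : T)).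

Local Open Scope group_scope.

Lemma reflection_invol c : reflection c * reflection c = 1.
Proof. by apply/permP => x; rewrite permM !permE GRing.subKr. Qed.

Lemma reflectionM : reflection 0%R * reflection 1%R = shift.
Proof. by apply/permP => x; rewrite permM !permE GRing.sub0r GRing.opprK. Qed.

Lemma order_shift : #[shift] = p.
Proof.
apply: nt_prime_order => //.
  apply/permP => x; rewrite permX (eq_iter (permE _)) GRing.iter_addr perm1.
  by have := @pchar_Zp p isT => /= ->; rewrite GRing.add0r.
apply/eqP => /permP /(_ 0%R); rewrite perm1 permE GRing.addr0 => /eqP.
by rewrite GRing.oner_eq0.
Qed.

Lemma card_perm_group_dvdn (G : {group {perm T}}) : (#|G| %| p`!)%N.
Proof. by rewrite -[p in p`!](card_ord p) -alt.card_Sym cardSg ?subsetT. Qed.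

Lemma pfactors_perm_lt q (G : {group {perm T}}) :
  prime q -> p < q -> pfactors q G = 0%N.
Proof.
move=> pq ltpq; apply: pfactors_eq0 => //; apply: contraL ltpq => qG.
rewrite -leqNgt; apply: (prime_dvdn_fact pq).
exact: dvdn_trans qG (card_perm_group_dvdn G).
Qed.

(** Such a group embeds in the symmetric group of degree p - 1, whose order is
    prime to p. *)
Lemma pfactors_perm_stab (G : {group {perm T}}) (x : T) :
  (forall g, g \in G -> g x = x) -> pfactors p G = 0%N.
Proof.
move=> Gx; apply: pfactors_eq0 => //; apply/negP => pG.
have : (p %| n.+1`!)%N.
  apply: dvdn_trans pG _.
  have GS : G \subset (perm.Sym [set~ x])%G.
    apply/subsetP => g gG; rewrite inE; apply/subsetP => y.
    rewrite !inE; apply: contraNneq => ->; by rewrite Gx.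
  apply: dvdn_trans (cardSg GS) _.
  by rewrite /= perm.card_Sym cardsC1 card_ord.
by move/(prime_dvdn_fact n_prime); rewrite ltnn.
Qed.

(** The rotations form a normal subgroup of order p, and p divides p! only once. *)
Lemma pfactors_dihedral (G : {group {perm T}}) :
  G :=: <<[set reflection 0%R; reflection 1%R]>> -> pfactors p G = 1%N.
Proof.
move=> GE; apply/eqP; rewrite eqn_leq; apply/andP; split.
  rewrite leqNgt; apply/negP => lt1.
  have : (p ^ 2 %| p * n.+1`!)%N.
    apply: dvdn_trans (dvdn_exp2l p lt1) _.
    exact: dvdn_trans (pfactors_dvdn G n_prime) (card_perm_group_dvdn G).
  rewrite -mulnn dvdn_pmul2l //.
  by move/(prime_dvdn_fact n_prime); rewrite ltnn.
have sG : <[shift]> \subset G.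
  rewrite GE gen_subG sub1set -reflectionM.
  by rewrite groupM // mem_gen // !inE eqxx ?orbT.
have nG : <[shift]> <| G.
  rewrite /normal sG GE gen_subG /=; apply/subsetP => g.
  have refl c : reflection c \in 'N(<[shift]>).
    rewrite inE -cycleJ cycle_subG.
    suff -> : shift ^ reflection c = shift^-1 by rewrite groupV cycle_id.
    apply/eqP; rewrite eq_sym eq_invg_mul conjgE; apply/eqP.
    have -> : (reflection c)^-1 = reflection c.
      by apply/eqP; rewrite eq_invg_mul reflection_invol.
    apply/permP => x; rewrite !permM !permE.
    by rewrite GRing.addrCA GRing.opprD GRing.addNKr GRing.opprB GRing.addrC GRing.addKr.
  by move=> /set2P[] ->; exact: refl.
have s1 : psteps p <[shift]>%G (0 + (#|<[shift]>%G : 1%G| == p)).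
  by apply: pstepsS; [exact: normal1|exact: psteps1].
have s2 := pstepsS nG s1.
move: (pfactors_max n_prime s2); rewrite indexg1 [#|_|]order_shift eqxx.
by apply: leq_trans; rewrite add0n leq_addr.
Qed.

(** A p-cycle and the transposition of two neighbours generate the symmetric
    group, which is the simple alternating group extended by a group of order
    two. *)
Lemma pfactors_Sym (G : {group {perm T}}) : 4 < p ->
  tperm 0%R 1%R \in G -> shift \in G -> pfactors p G = 0%N.
Proof.
move=> p5 tG sG.
have GE : G :=: [set: {perm T}].
  apply/eqP; rewrite eqEsubset subsetT /=.
  rewrite -(@gen_tpermn_circular_shift _ 0%R 1%R); last first.
    by rewrite GRing.subr0 /= modn_small // coprimen1.
  by rewrite gen_subG; apply/subsetP => g; rewrite !inE => /orP[] /eqP ->.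
have cT : #|T| = p := card_ord p.
have altG : 'ker_G (coset ('Alt_T)) = 'Alt_T.
  rewrite ker_coset GE; apply/setIidPr; exact: subsetT.
rewrite (@pfactors_morphim _ _ _ _ (coset_morphism 'Alt_T) G) //; last first.
  by rewrite /= GE -['N(_)]/('N('Alt_T)); apply: normal_norm (Alt_normal T).
have -> : ('ker_G (coset_morphism 'Alt_T))%G = 'Alt_T by exact: val_inj.
rewrite pfactors_simple //; last first.
  (* p!/2 = p would make (p - 1)! equal to 2 *)
  move=> cA.
  have := @card_Alt T; rewrite cT cA => /(_ isT)/eqP.
  rewrite factS mulnC eqn_pmul2l // eqn_leq => /andP[_].
  move: p5; rewrite !ltnS; case: n => [|[|m]] // _.
  rewrite leqNgt; case/negP.
  rewrite factS.
  by rewrite (@leq_trans (m.+3 * 1)) // leq_mul // fact_gt0.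
  by apply: simple_Alt5; rewrite cT.
rewrite add0n pfactors_eq0 //.
apply/negP => /dvdn_leq.
rewrite card_quotient ?GE; last exact: normal_norm (Alt_normal T).
rewrite Alt_index ?cT // => /(_ isT).
by rewrite leqNgt (leq_trans _ p5).
Qed.

End DihedralSymmetric.
(** * Finite images of a group and of a subgroup *)

Section FiniteImages.
Import boot.fintype boot.bigop boot.finset fingroup.perm.
Local Open Scope set_scope.
Local Open Scope group_scope.
Variable G : groupType.
Implicit Types (A B : set G) (gT : finGroupType).

Definition hom_on gT A (r : G -> gT) :=
  forall x y, A x -> A y -> r (x * y) = r x * r y.

(** The cosets of B in A then correspond to the cosets of the image of B in the
    image of A, which are finite groups. *)
Definition separates gT A B (r : G -> gT) :=
  hom_on A r /\ forall x, A x -> r x = 1 -> B x.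

Definition image_in gT (r : G -> gT) A : {set gT} :=
  finset (fun z => `[< exists2 x, A x & r x = z >]).

Lemma image_inP gT (r : G -> gT) A z :
  reflect (exists2 x, A x & r x = z) (z \in image_in r A).
Proof. by rewrite inE; exact: asboolP. Qed.

Definition image_grp gT (r : G -> gT) A : {group gT} := <<image_in r A>>%G.

Lemma hom_onW gT A B (r : G -> gT) :
  (B `<=` A)%classic -> hom_on A r -> hom_on B r.
Proof. by move=> BA hr x y Bx By; apply: hr; exact: BA. Qed.

Lemma image_grpE gT (r : G -> gT) A :
  is_subgroup A -> hom_on A r -> <<image_in r A>> = image_in r A.
Proof.
move=> [A1 AM AV] hr; apply: gen_set_id; apply/group_setP; split.
  apply/image_inP; exists 1 => //.
  by have := hr _ _ A1 A1; rewrite mulg1 => /esym /(canRL (mulKg _)); rewrite mulVg.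
move=> _ _ /image_inP[x Ax <-] /image_inP[y Ay <-].
by apply/image_inP; exists (x * y); [exact: AM|exact: hr].
Qed.

(** The kernel of f is contained in the images of both A and B, so passing to
    the quotient removes the same factors from the two. *)
Lemma pfactors_image_morphism p gT (rT : finGroupType) (f : {morphism [set: gT] >-> rT}) (r : G -> gT)
    A B : prime p -> is_subgroup A -> is_subgroup B -> (B `<=` A)%classic ->
  hom_on A r -> (forall x, A x -> f (r x) = 1 -> B x) ->
  (pfactors p (image_grp r A) + pfactors p (image_grp (f \o r) B) =
   pfactors p (image_grp r B) + pfactors p (image_grp (f \o r) A))%N.
Proof.
move=> pp sA sB BA hr kerB.
have hfr : hom_on A (f \o r).
  by move=> x y Ax Ay /=; rewrite hr // morphM ?inE.
have imE E : is_subgroup E -> hom_on E r -> hom_on E (f \o r) ->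
    (f @* image_grp r E)%G = image_grp (f \o r) E.
  move=> sE h1 h2; apply: val_inj; rewrite /= !image_grpE //.
  apply/setP => z; apply/idP/idP.
    case/morphimP => y _ yE ->; have [x Ex <-] := elimT (image_inP _ _ _) yE.
    by apply/image_inP; exists x.
  move=> /image_inP[x Ex <-]; apply/morphimP; exists (r x); rewrite ?in_setT //.
  by apply/image_inP; exists x.
have hrB := hom_onW BA hr; have hfrB := hom_onW BA hfr.
rewrite (@pfactors_morphim p _ _ _ f (image_grp r A)) ?subsetT //.
rewrite (@pfactors_morphim p _ _ _ f (image_grp r B)) ?subsetT //.
rewrite !imE //.
suff -> : ('ker_(image_grp r A) f = 'ker_(image_grp r B) f)%G by rewrite addnAC.
apply: val_inj; rewrite /= !image_grpE //.
apply/setP => z; rewrite !in_setI; apply/andP/andP => -[zE kz]; split=> //.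
  have [x Ax xz] := elimT (image_inP _ _ _) zE; apply/image_inP; exists x => //.
  by apply: kerB => //; rewrite xz; case/andP: kz => _; rewrite !inE => /eqP.
have [x Bx xz] := elimT (image_inP _ _ _) zE; apply/image_inP; exists x => //.
exact: BA.
Qed.

Lemma fst_morphic (gT rT : finGroupType) :
  {in [set: gT * rT] &, {morph (fun x : gT * rT => x.1) : x y / x * y}}.
Proof. by []. Qed.
Lemma snd_morphic (gT rT : finGroupType) :
  {in [set: gT * rT] &, {morph (fun x : gT * rT => x.2) : x y / x * y}}.
Proof. by []. Qed.

Lemma separates_pair (gT rT : finGroupType) A B (r : G -> gT) (s : G -> rT) :
  separates A B r -> separates A B s -> hom_on A (fun x => (r x, s x)).
Proof. by move=> [hr _] [hs _] x y Ax Ay /=; rewrite hr // hs. Qed.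

(** Two finite images are compared through the image in their product. *)
Lemma separates_indep p (gT rT : finGroupType) A B (r : G -> gT) (s : G -> rT) :
  prime p -> is_subgroup A -> is_subgroup B -> (B `<=` A)%classic ->
  separates A B r -> separates A B s ->
  (pfactors p (image_grp r A) + pfactors p (image_grp s B) =
   pfactors p (image_grp s A) + pfactors p (image_grp r B))%N.
Proof.
move=> pp sA sB BA sr ss.
have hrs := separates_pair sr ss.
pose rs x := (r x, s x).
have E1 : (pfactors p (image_grp rs A) + pfactors p (image_grp r B) =
           pfactors p (image_grp rs B) + pfactors p (image_grp r A))%N.
  exact: (@pfactors_image_morphism p _ _ (Morphism (@fst_morphic gT rT))
            rs A B pp sA sB BA hrs sr.2).
have E2 : (pfactors p (image_grp rs A) + pfactors p (image_grp s B) =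
           pfactors p (image_grp rs B) + pfactors p (image_grp s A))%N.
  exact: (@pfactors_image_morphism p _ _ (Morphism (@snd_morphic gT rT))
            rs A B pp sA sB BA hrs ss.2).
lia.
Qed.
End FiniteImages.
(** * Finite index and commensurability *)

Section Commensurability.
Local Open Scope group_scope.
Variable G : groupType.
Implicit Types (A B D H K : set G) (g h x y : G).

Lemma left_cosetP x B y : left_coset x B y <-> B (x^-1 * y).
Proof.
split=> [[b Bb <-]|By]; first by rewrite mulKg.
by exists (x^-1 * y) => //; rewrite mulVKg.
Qed.

Lemma left_coset_eqP B x y :
  is_subgroup B -> left_coset x B = left_coset y B <-> B (x^-1 * y).
Proof.
move=> [B1 BM BV]; split=> [xy|Bxy].
  by apply/left_cosetP; rewrite xy; apply/left_cosetP; rewrite mulVg.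
apply/seteqP; split=> z /left_cosetP Bz; apply/left_cosetP.
  have := BM _ _ (BV _ Bxy) Bz.
  by rewrite invgM invgK -mulgA mulVKg.
have := BM _ _ Bxy Bz.
by rewrite -mulgA mulVKg.
Qed.

Lemma is_subgroupI A B : is_subgroup A -> is_subgroup B -> is_subgroup (A `&` B).
Proof.
move=> [A1 AM AV] [B1 BM BV]; split=> //.
- by move=> x y [? ?] [? ?]; split; [exact: AM|exact: BM].
- by move=> x [? ?]; split; [exact: AV|exact: BV].
Qed.

(** The way finiteness of an index is established throughout: a function on A
    with finitely many values whose fibres lie in single cosets. *)
Lemma finite_index_fun (T : choiceType) (f : G -> T) A B :
  is_subgroup B -> finite_set (f @` A) ->
  (forall x y, A x -> A y -> f x = f y -> B (x^-1 * y)) -> finite_index B A.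
Proof.
move=> sB fA inj.
pose r t := xget 1 [set x | A x /\ f x = t].
apply: (@sub_finite_set _ _ ((fun t => left_coset (r t) B) @` (f @` A))); last first.
  exact: finite_image.
move=> _ [x Ax <-]; exists (f x); first by exists x.
apply/left_coset_eqP => //.
have [] : [set y | A y /\ f y = f x] (r (f x)).
  by apply: (@xgetPex _ 1 [set y | A y /\ f y = f x]); exists x.
by move=> Ar fr; apply: inj.
Qed.

Lemma finite_indexS A B D :
  is_subgroup B -> is_subgroup D -> D `<=` B -> finite_index D A -> finite_index B A.
Proof.
move=> sB sD DB fD; apply: (finite_index_fun sB fD) => x y _ _.
by move/left_coset_eqP => /(_ sD) /DB.
Qed.

Lemma finite_index_sub A B D :
  is_subgroup B -> D `<=` A -> finite_index B A -> finite_index B D.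
Proof.
move=> sB DA; apply: sub_finite_set => _ [x Dx <-].
by exists x => //; exact: DA.
Qed.

Lemma finite_indexI A B D :
  is_subgroup B -> is_subgroup D ->
  finite_index B A -> finite_index D A -> finite_index (B `&` D) A.
Proof.
move=> sB sD fB fD.
apply: (@finite_index_fun _ (fun x => (left_coset x B, left_coset x D))).
- exact: is_subgroupI.
- apply: sub_finite_set (finite_setX fB fD).
  by move=> _ [x Ax <-]; split; exists x.
- move=> x y _ _ [xyB xyD].
  by split; apply/left_coset_eqP.
Qed.

Lemma finite_index_trans A B D :
  is_subgroup A -> is_subgroup B -> is_subgroup D -> D `<=` B -> B `<=` A ->
  finite_index B A -> finite_index D B -> finite_index D A.
Proof.
move=> sA sB sD DB BA fB fD.
pose r (C : set G) := xget 1 C.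
have rP x : left_coset x B (r (left_coset x B)).
  apply: (@xgetPex _ 1 (left_coset x B)); exists x.
  by apply/left_cosetP; rewrite mulVg; case: sB.
apply: (@finite_index_fun _ (fun x => (left_coset x B,
  left_coset ((r (left_coset x B))^-1 * x) D))) => //.
- apply: sub_finite_set (finite_setX fB fD).
  move=> _ [x Ax <-]; split; first by exists x.
  exists ((r (left_coset x B))^-1 * x) => //.
  have /left_cosetP := rP x; case: sB => _ _ BV /BV.
  by rewrite invgM invgK.
- move=> x y _ _ [<-] /left_coset_eqP => /(_ sD).
  by rewrite invgM invgK -mulgA mulVKg.
Qed.

Lemma finite_index_refl A : is_subgroup A -> finite_index A A.
Proof.
move=> sA; apply: (@finite_index_fun _ (fun=> tt)) => //; first exact: finite_finset.
by case: sA => _ DM DV x y Dx Dy _; apply: DM => //; exact: DV.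
Qed.

Lemma conj_setE g A x : conj_set g A x <-> A (g^-1 * x * g).
Proof.
split=> [[y Ay <-]|Ay]; first by rewrite !mulgA mulVg mul1g mulgKV.
by exists (g^-1 * x * g) => //; rewrite !mulgA mulgV mul1g mulgK.
Qed.

Lemma conj_setM g h A : conj_set (g * h) A = conj_set g (conj_set h A).
Proof.
apply/seteqP; split=> x; rewrite !conj_setE invgM !mulgA //.
Qed.

Lemma conj_set1 A : conj_set 1 A = A.
Proof. by apply/seteqP; split=> x; rewrite conj_setE invg1 mul1g mulg1. Qed.

Lemma conj_setI g A B : conj_set g (A `&` B) = conj_set g A `&` conj_set g B.
Proof. by apply/seteqP; split=> x; rewrite /setI /= !conj_setE. Qed.

Lemma is_subgroup_conj g A : is_subgroup A -> is_subgroup (conj_set g A).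
Proof.
move=> [A1 AM AV]; split.
- by rewrite conj_setE mulg1 mulVg.
- move=> x y; rewrite !conj_setE => Ax Ay.
  by have := AM _ _ Ax Ay; rewrite !mulgA mulgK.
- by move=> x; rewrite !conj_setE => /AV; rewrite !invgM invgK mulgA.
Qed.

Lemma conj_set_self g A : is_subgroup A -> A g -> conj_set g A = A.
Proof.
move=> [A1 AM AV] Ag; apply/seteqP; split=> x; rewrite conj_setE => Ax.
  have := AM _ _ (AM _ _ Ag Ax) (AV _ Ag).
  by rewrite !mulgA mulgV mul1g mulgK.
by apply: (AM) => //; apply: AM => //; exact: AV.
Qed.

Lemma finite_index_conj g A B : is_subgroup B ->
  finite_index B A -> finite_index (conj_set g B) (conj_set g A).
Proof.
move=> sB fB.
apply: (@finite_index_fun _ (fun x => left_coset (g^-1 * x * g) B)).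
- exact: is_subgroup_conj.
- apply: sub_finite_set fB => _ [x Ax <-].
  by exists (g^-1 * x * g) => //; apply/conj_setE.
- move=> x y _ _ /left_coset_eqP => /(_ sB); rewrite conj_setE !invgM invgK.
  by rewrite !mulgA mulgK.
Qed.

Lemma commensurable_sym A B : commensurable A B -> commensurable B A.
Proof. by move=> [fA fB]; split; rewrite setIC. Qed.

Lemma commensurable_refl A : is_subgroup A -> commensurable A A.
Proof. by move=> sA; split; rewrite setIid; exact: finite_index_refl. Qed.

Lemma finite_index_commensurable A B : is_subgroup B -> B `<=` A ->
  finite_index B A -> commensurable A B.
Proof.
by move=> sB BA fB; rewrite /commensurable setIidr //; split => //; exact: finite_index_refl.
Qed.

Lemma commensurable_cap A B D :
  is_subgroup A -> is_subgroup B -> is_subgroup D ->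
  commensurable A B -> commensurable B D ->
  [/\ finite_index (A `&` B `&` D) A, finite_index (A `&` B `&` D) B
    & finite_index (A `&` B `&` D) D].
Proof.
move=> sA sB sD [AB BA] [BD DB].
have sAB := is_subgroupI sA sB; have sBD := is_subgroupI sB sD.
have s3 := is_subgroupI sAB sD.
have fB : finite_index (A `&` B `&` D) B.
  suff -> : A `&` B `&` D = (A `&` B) `&` (B `&` D) by exact: finite_indexI.
  by rewrite setIA -[A `&` B `&` B]setIA setIid.
split=> //.
- apply: (finite_index_trans sA sAB s3) => //.
  exact: finite_index_sub fB.
- apply: (finite_index_trans sD sBD s3) => //.
  + by move=> x [[]].
  + exact: finite_index_sub fB.
Qed.

Lemma commensurable_trans A B D :
  is_subgroup A -> is_subgroup B -> is_subgroup D ->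
  commensurable A B -> commensurable B D -> commensurable A D.
Proof.
move=> sA sB sD cAB cBD.
have [fA _ fD] := commensurable_cap sA sB sD cAB cBD.
have sAB := is_subgroupI sA sB; have s3 := is_subgroupI sAB sD.
have sAD := is_subgroupI sA sD.
by split; [move: fA|move: fD]; apply: finite_indexS => // x [[]].
Qed.

Lemma commensurable_conj g A B : is_subgroup A -> is_subgroup B ->
  commensurable A B -> commensurable (conj_set g A) (conj_set g B).
Proof.
move=> sA sB [fA fB]; rewrite /commensurable -conj_setI.
by split; apply: finite_index_conj => //; exact: is_subgroupI.
Qed.

Lemma is_subgroup_commensurator H K : is_subgroup H -> is_subgroup K ->
  is_subgroup (commensurator H K).
Proof.
move=> [H1 HM HV] sK; split.
- by split=> //; rewrite conj_set1; exact: commensurable_refl.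
- move=> x y [Hx cx] [Hy cy]; split; first exact: HM.
  rewrite conj_setM; apply: commensurable_trans cx _ => //.
  + exact: is_subgroup_conj.
  + by do 2 apply: is_subgroup_conj.
  + by apply: commensurable_conj => //; exact: is_subgroup_conj.
- move=> x [Hx cx]; split; first exact: HV.
  apply: commensurable_sym.
  have := commensurable_conj x^-1 sK (is_subgroup_conj x sK) cx.
  by rewrite -conj_setM mulVg conj_set1.
Qed.

Lemma sub_commensurator H K : is_subgroup K -> K `<=` H -> K `<=` commensurator H K.
Proof.
move=> sK KH x Kx; split; first exact: KH.
by rewrite conj_set_self //; exact: commensurable_refl.
Qed.

End Commensurability.
(** Representatives of the orbits, and group elements carrying each point to
    itself from its representative. *)
Lemma orbit_representatives (G : groupType) (X : choiceType)
    (act : G -> X -> X) (S : set G) : is_subgroup S ->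
  (forall x, act 1%g x = x) ->
  (forall h k x, act (h * k)%g x = act h (act k x)) ->
  exists (rep : X -> X) (tr : X -> G),
    [/\ forall x, S (tr x), forall x, act (tr x) (rep x) = x &
        forall h x, S h -> rep (act h x) = rep x].
Proof.
move=> [S1 SM SV] act1 actM.
have [[x0]|noX] := pselect (inhabited X); last first.
  by exists id, (fun=> 1%g); split=> // h x; case: noX; constructor.
have actK h x : act h^-1%g (act h x) = x by rewrite -actM mulVg act1.
pose orb x := [set y | exists2 h, S h & act h x = y].
pose rep x := xget x0 (orb x).
pose tr x := xget 1%g [set h | S h /\ act h (rep x) = x].
have trP x : S (tr x) /\ act (tr x) (rep x) = x.
  apply: (@xgetPex _ 1%g [set h | S h /\ act h (rep x) = x]).
  have [h Sh <-] : exists2 h, S h & act h x = rep x.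
    by apply: (@xgetPex _ x0 (orb x)); exists x; exists 1%g.
  by exists h^-1%g; split; [exact: SV|exact: actK].
exists rep, tr; split=> [x|x|h x Sh]; [by case: (trP x)|by case: (trP x)|].
rewrite /rep; congr xget; apply/seteqP; split=> u [k Sk <-].
  by exists (k * h)%g; [exact: SM|rewrite actM].
by exists (k * h^-1)%g; [apply: SM => //; exact: SV|rewrite actM actK].
Qed.
(** * The refined index *)

Section IndexRefinement.
Local Open Scope group_scope.
Variable G : groupType.
Implicit Types (A B D H K : set G) (g h x y : G).

(** A acts on the finite set of left cosets of B. Since the product s * t of
    finite permutations applies s first, it is x^-1 that has to act by left
    translation to make the action a homomorphism. *)
Lemma separates_exists A B : is_subgroup A -> is_subgroup B -> finite_index B A ->
  exists (n : nat) (r : G -> {perm 'I_n}), separates A B r.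
Proof.
move=> [A1 AM AV] sB [n /card_esym /card_set_bijP [f [fim finj fsurj]]].
have fA (i : 'I_n) : left_cosets A B (f i) by apply: fim => /=.
have code C : left_cosets A B C -> exists i : 'I_n, f i = C.
  by move=> /fsurj [m /= mn <-]; exists (Ordinal mn).
pose rep (i : 'I_n) : G := xget 1 [set x | A x /\ left_coset x B = f i].
have repP i : A (rep i) /\ left_coset (rep i) B = f i.
  by apply: (@xgetPex _ 1 [set x | A x /\ left_coset x B = f i]); have [x Ax <-] := fA i; exists x.
pose act x (i : 'I_n) : 'I_n := xget i [set j : 'I_n | f j = left_coset (x^-1 * rep i) B].
have actP x i : A x -> f (act x i) = left_coset (x^-1 * rep i) B.
  move=> Ax; apply: (@xgetPex _ i [set j : 'I_n | f j = left_coset (x^-1 * rep i) B]).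
  apply: code; exists (x^-1 * rep i) => //.
  by apply: AM; [exact: AV|case: (repP i)].
have f_inj (i j : 'I_n) : f i = f j -> i = j.
  by move=> fij; apply/val_inj; apply: finj => //; rewrite inE /=.
have actM x y i : A x -> A y -> act (x * y) i = act y (act x i).
  move=> Ax Ay; apply: f_inj; rewrite !actP //; last exact: AM.
  have := (repP (act x i)).2; rewrite actP // => /left_coset_eqP => /(_ sB) H.
  apply/left_coset_eqP => //; case: sB => _ _ BV.
  have := BV _ H; rewrite !invgM !invgK !mulgA.
  by rewrite mulgK.
have act1 i : act 1 i = i.
  by apply: f_inj; rewrite actP // invg1 mul1g; case: (repP i).
have act_inj x : A x -> injective (act x).
  move=> Ax; apply: (can_inj (g := act x^-1)) => i.
  by rewrite -actM ?mulgV ?act1 //; exact: AV.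
pose r x : {perm 'I_n} :=
  if pselect (A x) is left Ax then perm (act_inj x Ax) else 1.
have rE x i : A x -> r x i = act x i.
  by move=> Ax; rewrite /r; case: pselect => // Ax'; rewrite permE.
exists n, r; split.
  by move=> x y Ax Ay; apply/perm.permP => i; rewrite permM !rE ?actM //; exact: AM.
move=> x Ax rx1.
have [i fi] := code (left_coset 1 B) (imageP _ A1).
have := rE x i Ax; rewrite rx1 perm1 => /(congr1 (fun k : 'I_n => f k)); rewrite actP // -(repP i).2.
move=> /left_coset_eqP => /(_ sB).
have := (repP i).2; rewrite fi => /left_coset_eqP => /(_ sB).
rewrite mulg1 => Bi.
case: sB => _ BM BV Bx; have Br := BV _ Bi; rewrite invgK in Br.
have := BV _ (BM _ _ (BM _ _ Br Bx) Bi).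
by rewrite mulVKg mulgK invgK.
Qed.

(** Summing the analogous numbers over all finite simple groups, weighted by the
    logarithms of their orders, would give the logarithm of the index. By
    refined_indexE every separating homomorphism computes the same value. *)
Definition refined_index p A B : int :=
  xget 0%R [set z : int | exists (gT : finGroupType) (r : G -> gT), separates A B r /\
    z = ((pfactors p (image_grp r A))%:Z - (pfactors p (image_grp r B))%:Z)%R].

Lemma refined_indexE p A B (gT : finGroupType) (r : G -> gT) :
  prime p -> is_subgroup A -> is_subgroup B -> B `<=` A -> separates A B r ->
  refined_index p A B =
    ((pfactors p (image_grp r A))%:Z - (pfactors p (image_grp r B))%:Z)%R.
Proof.
move=> pp sA sB BA sr; apply: xget_unique; first by exists gT, r.
move=> _ [rT [s [ss ->]]].
have := separates_indep pp sA sB BA sr ss; lia.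
Qed.

Lemma refined_index_trans p A B D : prime p ->
  is_subgroup A -> is_subgroup B -> is_subgroup D -> D `<=` B -> B `<=` A ->
  finite_index D A ->
  refined_index p A D = (refined_index p A B + refined_index p B D)%R.
Proof.
move=> pp sA sB sD DB BA fD; have [n [r [hr kr]]] := separates_exists sA sD fD.
have rAD : separates A D r by [].
have rAB : separates A B r by split => // x Ax rx1; apply: DB; exact: kr.
have rBD : separates B D r.
  by split; [exact: hom_onW hr|move=> x Bx; apply: kr; exact: BA].
rewrite (refined_indexE pp sA sD _ rAD); last exact: subset_trans DB BA.
rewrite (refined_indexE pp sA sB BA rAB) (refined_indexE pp sB sD DB rBD).
lia.
Qed.

Lemma refined_index_refl p A : prime p -> is_subgroup A -> refined_index p A A = 0%R.
Proof.
move=> pp sA; have := refined_index_trans pp sA sA sA (@subset_refl _ A) (@subset_refl _ A).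
move/(_ (finite_index_refl sA)); lia.
Qed.

Lemma refined_index_conj p g A B : prime p ->
  is_subgroup A -> is_subgroup B -> B `<=` A -> finite_index B A ->
  refined_index p (conj_set g A) (conj_set g B) = refined_index p A B.
Proof.
move=> pp sA sB BA fB; have [n [r [hr kr]]] := separates_exists sA sB fB.
pose s x := r (g^-1 * x * g).
have ss : separates (conj_set g A) (conj_set g B) s.
  split=> [x y|x]; rewrite !conj_setE; last exact: kr.
  move=> Ax Ay; rewrite /s -hr //; congr r.
  by rewrite !mulgA mulgK.
have imE E : image_in s (conj_set g E) = image_in r E.
  apply/finset.setP => z; apply/idP/idP => /image_inP[x].
    by rewrite conj_setE => Ex <-; apply/image_inP; exists (g^-1 * x * g).
  move=> Ex <-; apply/image_inP; exists (g * x * g^-1); first by exists x.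
  by rewrite /s !mulgA mulVg mul1g mulgKV.
rewrite (refined_indexE pp _ _ _ ss); try exact: is_subgroup_conj; last first.
  by move=> x; rewrite !conj_setE => /BA.
by rewrite (refined_indexE pp sA sB BA (conj hr kr)) /image_grp !imE.
Qed.

Lemma refined_index_large A B : is_subgroup A -> is_subgroup B -> B `<=` A ->
  finite_index B A ->
  exists N, forall p, prime p -> (N < p)%N -> refined_index p A B = 0%R.
Proof.
move=> sA sB BA fB; have [n [r sr]] := separates_exists sA sB fB.
exists #|{perm 'I_n}| => p pp ltp; rewrite (refined_indexE pp sA sB BA sr).
suff E (H : {group {perm 'I_n}}) : pfactors p H = 0%N by rewrite !E.
apply: pfactors_eq0 => //; apply/negP => /dvdn_leq; rewrite cardG_gt0 => /(_ isT).
by rewrite leqNgt (leq_ltn_trans (max_card _) ltp).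
Qed.

Definition index_gap p A B : int :=
  (refined_index p A (A `&` B) - refined_index p B (A `&` B))%R.

Lemma index_gapE p A B E : prime p ->
  is_subgroup A -> is_subgroup B -> is_subgroup E -> E `<=` A `&` B ->
  finite_index E A -> finite_index E B ->
  index_gap p A B = (refined_index p A E - refined_index p B E)%R.
Proof.
move=> pp sA sB sE EAB fA fB; have sAB := is_subgroupI sA sB.
rewrite (refined_index_trans pp sA sAB sE EAB _ fA); last by move=> x [].
rewrite (refined_index_trans pp sB sAB sE EAB _ fB); last by move=> x [].
rewrite /index_gap; lia.
Qed.

(** Both sides are computed on the common subgroup of finite index, the
    intersection of the three groups. *)
Lemma index_gap_trans p A B D : prime p ->
  is_subgroup A -> is_subgroup B -> is_subgroup D ->
  commensurable A B -> commensurable B D ->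
  index_gap p A D = (index_gap p A B + index_gap p B D)%R.
Proof.
move=> pp sA sB sD cAB cBD; have [fA fB fD] := commensurable_cap sA sB sD cAB cBD.
have s3 := is_subgroupI (is_subgroupI sA sB) sD.
rewrite (index_gapE pp sA sD s3 _ fA fD); last by move=> x [[]].
rewrite (index_gapE pp sA sB s3 _ fA fB); last by move=> x [[]].
rewrite (index_gapE pp sB sD s3 _ fB fD); last by move=> x [[]].
lia.
Qed.

Lemma index_gap_conj p g A B : prime p -> is_subgroup A -> is_subgroup B ->
  commensurable A B ->
  index_gap p (conj_set g A) (conj_set g B) = index_gap p A B.
Proof.
move=> pp sA sB [fA fB]; rewrite /index_gap -conj_setI.
have sAB := is_subgroupI sA sB.
by rewrite !refined_index_conj // => x [].
Qed.

Lemma index_gap_sub p A B : prime p -> is_subgroup A -> is_subgroup B ->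
  B `<=` A -> index_gap p A B = refined_index p A B.
Proof.
by move=> pp sA sB BA; rewrite /index_gap setIidr // refined_index_refl // GRing.subr0.
Qed.

Lemma index_gap_sym p A B : index_gap p B A = (- index_gap p A B)%R.
Proof. by rewrite /index_gap setIC GRing.opprB. Qed.

(** A prime larger than the order of a finite group is the order of none of its
    composition factors. *)
Lemma index_gap_large A B : is_subgroup A -> is_subgroup B -> commensurable A B ->
  exists N, forall p, prime p -> (N < p)%N -> index_gap p A B = 0%R.
Proof.
move=> sA sB [fA fB]; have sAB := is_subgroupI sA sB.
have [N1 N1P] := refined_index_large sA sAB (@subIsetl _ A B) fA.
have [N2 N2P] := refined_index_large sB sAB (@subIsetr _ A B) fB.
exists (maxn N1 N2) => p pp; rewrite gtn_max => /andP[l1 l2].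
by rewrite /index_gap N1P // N2P.
Qed.

Section Displacement.
Variables (H K : set G).
Hypotheses (sH : is_subgroup H) (sK : is_subgroup K).
Local Notation C := (commensurator H K).

Definition displacement p g : int := index_gap p K (conj_set g K).

(** From K to its conjugate by g, and from there to the conjugate by g * h: the
    second gap is that between K and its conjugate by h, conjugated by g. *)
Lemma displacementM p g h : prime p -> C g -> C h ->
  displacement p (g * h) = (displacement p g + displacement p h)%R.
Proof.
move=> pp [_ cg] [_ ch]; rewrite /displacement conj_setM.
rewrite (@index_gap_trans p K (conj_set g K)) //.
- by congr (_ + _)%R; apply: index_gap_conj => //; exact: is_subgroup_conj.
- exact: is_subgroup_conj.
- by do 2 apply: is_subgroup_conj.
- by apply: commensurable_conj => //; exact: is_subgroup_conj.
Qed.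

Lemma displacement_base p g : prime p -> K g -> displacement p g = 0%R.
Proof.
move=> pp Kg; rewrite /displacement conj_set_self //.
by rewrite /index_gap GRing.subrr.
Qed.

(** Conjugation invariance makes the displacement independent of the choice of
    the group within its commensurability class. *)
Lemma displacement_commensurable p g A : prime p -> C g ->
  is_subgroup A -> commensurable A K ->
  displacement p g = index_gap p A (conj_set g A).
Proof.
move=> pp [_ cg] sA cA.
have sgK := is_subgroup_conj g sK; have sgA := is_subgroup_conj g sA.
have cgA := commensurable_conj g sA sK cA.
rewrite (index_gap_trans pp sA sK sgA cA); last first.
  exact: commensurable_trans cg (commensurable_sym cgA).
rewrite (index_gap_trans pp sK sgK sgA cg (commensurable_sym cgA)).
rewrite (index_gap_sym p (conj_set g A)) index_gap_conj // /displacement; lia.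
Qed.

Lemma displacement_large g : C g ->
  exists N, forall p, prime p -> (N < p)%N -> displacement p g = 0%R.
Proof. by move=> [_ cg]; apply: index_gap_large => //; exact: is_subgroup_conj. Qed.

End Displacement.
End IndexRefinement.
(** * Homomorphisms on the completion *)

Section SymTopology.
Local Open Scope group_scope.
Variable X : choiceType.
Implicit Types s t : Sym X.

(** The sets on the right form a filter converging to s, by the description of
    convergence in Sym X; this gives a basis of neighbourhoods. *)
Lemma nbhs_symP s (U : set (Sym X)) : nbhs s U <->
  exists L : seq X, forall t, (forall x, x \in L -> t x = s x) -> U t.
Proof.
split; last first.
  move=> [L LU].
  suff H : nbhs s [set t : Sym X | forall x, x \in L -> t x = s x].
    by apply: filterS H => t /= Ht; exact: LU.
  elim: L {LU} => [|y L IH]; first by apply: filterS filterT => t _ x.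
  apply: filterS (filterI (sym_near s y) IH) => t [/= ty tL] x.
  by rewrite inE => /orP[/eqP->|/tL].
pose F : set_system (Sym X) := fun U =>
  exists L : seq X, forall t, (forall x, x \in L -> t x = s x) -> U t.
have FF : Filter F.
  split.
  - by exists [::].
  - move=> P Q [L LP] [M MQ]; exists (L ++ M) => t tLM; split.
      by apply: LP => x xL; apply: tLM; rewrite mem_cat xL.
    by apply: MQ => x xM; apply: tLM; rewrite mem_cat xM orbT.
  - by move=> P Q PQ [L LP]; exists L => t /LP /PQ.
have : F --> s.
  by apply/sym_cvgP => x; exists [:: x] => t /(_ x); rewrite inE eqxx; apply.
by move=> /[apply].
Qed.

Lemma closure_symP (S : set (Sym X)) s : closure S s <->
  forall L : seq X, exists2 t, S t & forall x, x \in L -> t x = s x.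
Proof.
split=> [Ss L|H B /nbhs_symP[L LB]]; last first.
  by have [t St tL] := H L; exists t; split=> //; exact: LB.
have [|t [St /= tL]] := Ss [set t : Sym X | forall x, x \in L -> t x = s x].
  by apply/nbhs_symP; exists L.
by exists t.
Qed.

Lemma symM_E s t x : (s * t) x = s (t x). Proof. by []. Qed.

Lemma symK s : cancel s (s^-1)%g. Proof. exact: (sym_invK s).1. Qed.
Lemma symVK s : cancel (s^-1)%g s. Proof. exact: (sym_invK s).2. Qed.

Lemma is_subgroup_closure (S : set (Sym X)) :
  is_subgroup S -> is_subgroup (closure S).
Proof.
move=> [S1 SM SV]; split.
- by apply: subset_closure.
- move=> s t /closure_symP Ss /closure_symP St; apply/closure_symP => L.
  have [t' St' t'L] := St L; have [s' Ss' s'L] := Ss (map t L).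
  exists (s' * t'); first exact: SM.
  by move=> x xL; rewrite !symM_E t'L // s'L // map_f.
- move=> s /closure_symP Ss; apply/closure_symP => L.
  have [s' Ss' s'L] := Ss (map (s^-1)%g L).
  exists s'^-1; first exact: SV.
  move=> x xL; apply: (can_inj (symK s')); rewrite symVK s'L ?symVK //.
  exact: map_f.
Qed.

(** Conditions on the image of one point define clopen sets. *)
Lemma open_eval x (P : X -> Prop) : open [set s : Sym X | P (s x)].
Proof.
rewrite openE => s /= Ps; apply/nbhs_symP; exists [:: x] => t /(_ x).
by rewrite inE eqxx /= => ->.
Qed.

Lemma closed_eval x (P : X -> Prop) : closed [set s : Sym X | P (s x)].
Proof.
have -> : [set s : Sym X | P (s x)] = ~` [set s : Sym X | ~ P (s x)].
  by apply/seteqP; split=> s /=; [move=> ? ?|exact: contrapT].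
exact: (open_closedC (open_eval x (fun y => ~ P y))).
Qed.

End SymTopology.

Section CompletionQuotient.
Local Open Scope group_scope.
Variables (G : groupType) (C K : set G) (A : zmodType) (phi : G -> A).
Hypotheses (sC : is_subgroup C) (sK : is_subgroup K) (KC : K `<=` C).
Hypothesis phiM : forall x y, C x -> C y -> phi (x * y) = (phi x + phi y)%R.
Hypothesis phiK : forall x, K x -> phi x = 0%R.
Local Notation X := (coset_space C K).
Implicit Types (s t : Sym X) (a b : X).

Lemma left_cosetM x y (B : set G) :
  left_coset (x * y) B = left_coset x (left_coset y B).
Proof.
by apply/seteqP; split=> z /left_cosetP;
  [|move=> /left_cosetP]; rewrite ?invgM -?mulgA => Bz;
  apply/left_cosetP; [apply/left_cosetP|rewrite invgM -mulgA].
Qed.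

Lemma left_coset1 (B : set G) : left_coset 1 B = B.
Proof. by apply/seteqP; split=> z; rewrite left_cosetP invg1 mul1g. Qed.

Lemma coset_valP a : exists2 c, C c & set_val a = left_coset c K.
Proof. have [c Cc ac] := set_valP a; exists c => //; exact: esym ac. Qed.

Definition mk_coset c (Cc : C c) : X :=
  exist _ (left_coset c K) (mem_set (imageP (fun x => left_coset x K) Cc)).

Lemma mk_cosetE c (Cc : C c) : set_val (mk_coset Cc) = left_coset c K.
Proof. by []. Qed.

Definition base_coset : X := mk_coset (let: And3 C1 _ _ := sC in C1).

Lemma base_cosetE : set_val base_coset = left_coset 1 K. Proof. by []. Qed.

(** The extension of phi to the completion: its value at s is read off from the
    coset to which s moves the trivial coset. *)
Definition completion_hom s : A :=
  phi (xget 1 [set c | C c /\ set_val (s base_coset) = left_coset c K]).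

Lemma completion_homE s c : C c -> set_val (s base_coset) = left_coset c K ->
  completion_hom s = phi c.
Proof.
move=> Cc sc; rewrite /completion_hom.
have [] : [set c | C c /\ set_val (s base_coset) = left_coset c K]
    (xget 1 [set c | C c /\ set_val (s base_coset) = left_coset c K]).
  by apply: (@xgetPex _ 1 [set c | C c /\ set_val (s base_coset) = left_coset c K]); exists c.
set x := xget _ _ => Cx; rewrite sc => /left_coset_eqP => /(_ sK) Kcx.
have -> : x = c * (c^-1 * x) by rewrite mulVKg.
rewrite phiM //; last by apply: KC.
by rewrite (phiK Kcx) GRing.addr0.
Qed.

Lemma translation_exists c : C c ->
  exists2 s, left_translations C K s & set_val (s base_coset) = left_coset c K.
Proof.
move=> Cc; case: (sC) => C1 CM CV.
have mk x a : C x -> exists b : X, set_val b = left_coset x (set_val a).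
  move=> Cx; have [y Cy ->] := coset_valP a.
  by exists (mk_coset (CM _ _ Cx Cy)); rewrite mk_cosetE left_cosetM.
pose f x a : X := xget a [set b : X | set_val b = left_coset x (set_val a)].
have fP x a : C x -> set_val (f x a) = left_coset x (set_val a).
  move=> Cx; apply: (@xgetPex _ a [set b : X | set_val b = left_coset x (set_val a)]).
  exact: mk.
have val_inj' a b : set_val a = set_val b -> a = b by exact: val_inj.
have Cc' := CV _ Cc.
have fb : bijective (f c).
  exists (f c^-1) => a; apply: val_inj'; rewrite !fP // -left_cosetM.
    by rewrite mulVg left_coset1.
  by rewrite mulgV left_coset1.
exists (MkSym fb); first by exists c => // a; exact: fP.
have -> : MkSym fb base_coset = f c base_coset by [].
by rewrite fP // base_cosetE -left_cosetM mulg1.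
Qed.

Lemma is_subgroup_translations : is_subgroup (left_translations C K).
Proof.
case: sC => C1 CM CV; split.
- by exists 1 => // a; rewrite left_coset1.
- move=> s t [c Cc sc] [e Ce te]; exists (c * e); first exact: CM.
  by move=> a; rewrite symM_E sc te left_cosetM.
- move=> s [c Cc sc]; exists c^-1; first exact: CV.
  by move=> a; rewrite -[a in RHS](symVK s) sc -left_cosetM mulVg left_coset1.
Qed.

Lemma is_subgroup_completion : is_subgroup (completion C K).
Proof. exact/is_subgroup_closure/is_subgroup_translations. Qed.

(** On any two given cosets, s acts like an element of C; they are taken to be
    the trivial coset and its image under t. *)
Lemma completion_homM s t : completion C K s ->
  completion_hom (s * t) = (completion_hom s + completion_hom t)%R.
Proof.
move=> /closure_symP /(_ [:: base_coset; t base_coset]) [u [c Cc uc] us].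
have [e Ce te] := coset_valP (t base_coset).
have sb : set_val (s base_coset) = left_coset c K.
  by rewrite -us ?inE ?eqxx // uc base_cosetE -left_cosetM mulg1.
have stb : set_val ((s * t) base_coset) = left_coset (c * e) K.
  by rewrite symM_E -us ?inE ?eqxx ?orbT // uc te left_cosetM.
case: (sC) => _ CM _.
by rewrite (completion_homE (CM _ _ Cc Ce) stb) (completion_homE Cc sb)
  (completion_homE Ce te) phiM.
Qed.

Lemma completion_hom1 : completion_hom 1 = 0%R.
Proof.
have [C1 _ _] := sC; rewrite (@completion_homE _ 1) //.
by apply: phiK; case: sK.
Qed.

Lemma completion_homV s : completion C K s ->
  completion_hom s^-1 = (- completion_hom s)%R.
Proof.
move=> Cs; apply/eqP; rewrite -GRing.addr_eq0 GRing.addrC -completion_homM //.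
by rewrite mulgV completion_hom1.
Qed.

Lemma completion_hom_surj c : C c ->
  exists2 s, completion C K s & completion_hom s = phi c.
Proof.
move=> Cc; have [s sT sc] := translation_exists Cc; exists s.
  exact: subset_closure.
exact: completion_homE.
Qed.

Lemma completion_homX s n : completion C K s ->
  completion_hom (s ^+ n) = (completion_hom s *+ n)%R.
Proof.
move=> Cs; elim: n => [|n IH]; first by rewrite expg0 completion_hom1.
by rewrite expgS completion_homM // IH GRing.mulrS.
Qed.

End CompletionQuotient.
(** * Consequences for the completion *)

Section CompletionConsequences.
Local Open Scope group_scope.
Variables (G : groupType) (C K : set G).
Hypotheses (sC : is_subgroup C) (sK : is_subgroup K) (KC : K `<=` C).

Lemma finite_index_power (H : groupType) (A B : set H) x :
  is_subgroup A -> is_subgroup B -> finite_index B A -> A x ->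
  exists n, B (x ^+ n.+1).
Proof.
move=> [A1 AM AV] sB fB Ax.
have Axn n : A (x ^+ n) by elim: n => [|n IH]; rewrite ?expg0 // expgS; exact: AM.
apply: contrapT => none; apply: infinite_nat.
have -> : [set: nat] = (fun n => left_coset (x ^+ n) B) @^-1` left_cosets A B.
  by apply/seteqP; split=> n //= _; exists (x ^+ n).
apply: finite_preimage => // i j _ _.
wlog ij : i j / (i <= j)%N => [W eqij|].
  by case: (leqP i j) => [/W|/ltnW/W/(_ (esym eqij))//]; apply.
move=> /left_coset_eqP => /(_ sB).
rewrite -(subnKC ij) expgD mulKg => Bij.
case: (posnP (j - i)) => [->|ji]; first by rewrite addn0.
by case: none; exists (j - i).-1; rewrite prednK.
Qed.

(** The subgroup is the kernel of the extension of phi; its elements are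
    recognised by the image of the trivial coset, so it is open. *)
Lemma completion_quotient (I : choiceType) (phi : G -> {freeg I}) :
  (forall x y, C x -> C y -> phi (x * y) = (phi x + phi y)%R) ->
  (forall x, K x -> phi x = 0%R) ->
  (forall a, exists2 c, C c & phi c = a) -> infinite_set [set: I] ->
  exists N : set (Sym (coset_space C K)),
    [/\ normal_subgroup N (completion C K), open_in (completion C K) N &
        quotient_free_abelian_infinite_rank (completion C K) N].
Proof.
move=> phiM phiK phi_surj infI.
pose Phi := completion_hom phi sC (K:=K).
have PhiM := completion_homM sC sK KC phiM phiK.
have Phi1 := completion_hom1 sC sK KC phiM phiK.
have PhiV := completion_homV sC sK KC phiM phiK.
have sH := is_subgroup_completion K sC.
have [H1 HM HV] := sH.
pose N := [set s | completion C K s /\ Phi s = 0%R].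
have sN : is_subgroup N.
  split.
  - by split=> //; exact: Phi1.
  - move=> s t [Hs Ps] [Ht Pt]; split; first exact: HM.
    by rewrite /Phi PhiM // -/Phi -/(Phi t) Ps Pt GRing.addr0.
  - move=> s [Hs Ps]; split; first exact: HV.
    by rewrite /Phi PhiV // -/(Phi s) Ps GRing.oppr0.
have cosetE s t : completion C K s -> completion C K t ->
    left_coset s N = left_coset t N <-> Phi s = Phi t.
  move=> Hs Ht; rewrite left_coset_eqP //.
  have E : Phi (s^-1 * t) = (- Phi s + Phi t)%R.
    by rewrite /Phi PhiM ?PhiV //; exact: HV.
  split=> [[_ ]|st].
    by rewrite E GRing.addrC => /GRing.subr0_eq.
  by split; [apply: HM => //; exact: HV|rewrite E st GRing.addNr].
have nN : normal_subgroup N (completion C K).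
  split=> //; first by move=> s [].
  move=> h Hh; have Hh' := HV _ Hh.
  apply/seteqP; split=> s; rewrite conj_setE => -[Hs Ps].
    have Hs' : completion C K s.
      have := HM _ _ (HM _ _ Hh Hs) Hh'.
      by rewrite !mulgA mulgV mul1g mulgK.
    split => //; move: Ps; rewrite /Phi PhiM; last exact: HM.
    by rewrite PhiM // PhiV // GRing.addrAC GRing.addNr GRing.add0r.
  split; first by apply: (HM) => //; apply: (HM).
  rewrite /Phi PhiM; last exact: HM.
  by rewrite PhiM // PhiV // GRing.addrAC GRing.addNr GRing.add0r.
exists N; split => //.
- pose P (a : coset_space C K) :=
    phi (xget 1 [set c | C c /\ set_val a = left_coset c K]) = 0%R.
  rewrite /open_in.
  have -> : N = completion C K `&` [set s : Sym (coset_space C K) |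
     P (s (base_coset K sC))] by [].
  rewrite open_subspaceTI.
  by apply: open_subspaceW; exact: (open_eval _ P).
- pose f (B : set (Sym (coset_space C K))) : {freeg I} :=
    Phi (xget 1 [set s | completion C K s /\ left_coset s N = B]).
  have fE s : completion C K s -> f (left_coset s N) = Phi s.
    move=> Hs; rewrite /f.
    have [] : [set t | completion C K t /\ left_coset t N = left_coset s N]
      (xget 1 [set t | completion C K t /\ left_coset t N = left_coset s N]).
      by apply: (@xgetPex _ 1 [set t | completion C K t /\ left_coset t N = left_coset s N]); exists s.
    by move=> Hx /cosetE; apply.
  exists I, f; split=> //.
  + split => //.
    * move=> B D /set_mem [s Hs <-] /set_mem [t Ht <-].
      by rewrite !fE // => /cosetE; apply.
    * move=> a _; have [c Cc <-] := phi_surj a.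
      have [s Hs sE] := completion_hom_surj sC sK KC phiM phiK Cc.
      by exists (left_coset s N); [exists s|rewrite fE].
  + move=> B D [s Hs <-] [t Ht <-].
    suff -> : set_mul (left_coset s N) (left_coset t N) = left_coset (s * t) N.
      have Hst := HM _ _ Hs Ht.
      by rewrite !fE // /Phi PhiM.
    have [_ _ nt] := nN; have [N1 NM NV] := sN.
    apply/seteqP; split=> [_ [_ [x Nx <-] [_ [y Ny <-] <-]]|_ [y Ny <-]].
      apply/left_cosetP.
      have : conj_set t^-1 N (t^-1 * x * t).
        by apply/conj_setE; rewrite invgK !mulgA mulgV mul1g mulgK.
      rewrite (nt _ (HV _ Ht)) => Nx'.
      have := NM _ _ Nx' Ny.
      by rewrite invgM !mulgA mulgVK.
    exists s; first by exists 1 => //; rewrite mulg1.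
    by exists (t * y); [exists y|rewrite mulgA].
Qed.

(** If L is a subgroup of finite index, the kernel of phi1 in L is closed and
    normal in L. It contains a power of the translation by c2, which is not 1
    since phi2 detects it, and misses a power of the translation by c1 that lies
    in L. *)
Lemma completion_not_virtually_simple (phi1 phi2 : G -> int) (c1 c2 : G) :
  (forall x y, C x -> C y -> phi1 (x * y) = (phi1 x + phi1 y)%R) ->
  (forall x, K x -> phi1 x = 0%R) ->
  (forall x y, C x -> C y -> phi2 (x * y) = (phi2 x + phi2 y)%R) ->
  (forall x, K x -> phi2 x = 0%R) ->
  C c1 -> C c2 -> phi1 c1 <> 0%R -> phi1 c2 = 0%R -> phi2 c2 <> 0%R ->
  ~ virtually_topologically_simple (completion C K).
Proof.
move=> phi1M phi1K phi2M phi2K C1 C2 p11 p12 p22 [L [sL LH cL fL tsL]].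
have sH := is_subgroup_completion K sC; have [H1 HM HV] := sH.
have [s1 Hs1 s1E] := completion_hom_surj sC sK KC phi1M phi1K C1.
have [s2 s2T s2v] := translation_exists K sC C2.
have Hs2 : completion C K s2 by exact: subset_closure.
pose Phi := completion_hom phi1 sC (K:=K).
have PhiM := completion_homM sC sK KC phi1M phi1K.
have Phi1 := completion_hom1 sC sK KC phi1M phi1K.
have PhiV := completion_homV sC sK KC phi1M phi1K.
have [n1 L1] := finite_index_power sH sL fL Hs1.
have [n2 L2] := finite_index_power sH sL fL Hs2.
have [LL1 LM LV] := sL.
pose N := [set s | L s /\ Phi s = 0%R].
case: (tsL N).
- split.
  + split.
    * by split=> //; exact: Phi1.
    * move=> s t [Ls Ps] [Lt Pt]; split; first exact: LM.
      by rewrite /Phi (PhiM _ _ (LH _ Ls)) -/(Phi s) -/(Phi t) Ps Pt GRing.addr0.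
    * move=> s [Ls Ps]; split; first exact: LV.
      by rewrite /Phi (PhiV _ (LH _ Ls)) -/(Phi s) Ps GRing.oppr0.
  + by move=> s [].
  + move=> h Lh; have Lh' := LV _ Lh.
    have PJ s : L s -> Phi (h^-1 * s * h) = Phi s.
      move=> Ls; rewrite /Phi PhiM; last by apply: LH; exact: LM.
      by rewrite (PhiM _ _ (LH _ Lh')) (PhiV _ (LH _ Lh)) GRing.addrAC GRing.addNr GRing.add0r.
    apply/seteqP; split=> s; rewrite conj_setE => -[Ls Ps].
      have Ls' : L s.
        have := LM _ _ (LM _ _ Lh Ls) Lh'.
        by rewrite !mulgA mulgV mul1g mulgK.
      by split => //; rewrite -PJ.
    by split; [by apply: (LM) => //; apply: (LM)|rewrite PJ].
- pose P (a : coset_space C K) :=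
    phi1 (xget 1 [set c | C c /\ set_val a = left_coset c K]) = 0%R.
  rewrite /closed_in.
  have -> : N = L `&` [set s : Sym (coset_space C K) |
     P (s (base_coset K sC))] by [].
  apply: (@closedI (subspace L)).
    exact: closed_subspaceT.
  exact: (closed_subspaceW (@closed_eval _ (base_coset K sC) P)).
- move=> N1; have : N (s2 ^+ n2.+1).
    split=> //; rewrite /Phi (completion_homX sC sK KC phi1M phi1K) //.
    by rewrite (completion_homE sK KC phi1M phi1K C2 s2v) p12 GRing.mul0rn.
  rewrite N1 => /= s2n.
  have := completion_homX sC sK KC phi2M phi2K n2.+1 Hs2.
  rewrite s2n (completion_hom1 sC sK KC phi2M phi2K).
  rewrite (completion_homE sK KC phi2M phi2K C2 s2v) => /esym/eqP.
  by rewrite Num.Theory.mulrn_eq0 => /eqP.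
- move=> NL; move: L1; rewrite -NL => -[_].
  rewrite /Phi (completion_homX sC sK KC phi1M phi1K) // s1E => /eqP.
  by rewrite Num.Theory.mulrn_eq0 => /eqP.
Qed.

End CompletionConsequences.
(** * Maps onto the free abelian group on the primes *)

Section TriangularFamilies.
Local Open Scope group_scope.

(** The alternating group of degree p is simple for these primes p. *)
Definition large_prime := {p : nat | prime p && (4 < p)%N}.

Lemma large_prime_infinite : infinite_set [set: large_prime].
Proof.
move=> fI; have := finite_image (fun p : large_prime => val p) fI.
move=> /finite_seqP [s sE].
have [p] := prime_above (maxn 4 (\max_(i <- s) i)); rewrite gtn_max => /andP[p4 ps] pp.
have : [set` s] p.
  rewrite -sE; exists (exist _ p (introT andP (conj pp p4))) => //.
by move=> /= pS; move: ps; rewrite ltnNge leq_bigmax_seq.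
Qed.

Lemma freeg_of_coeff (f : large_prime -> int) N :
  (forall p : large_prime, (N < val p)%N -> f p = 0%R) ->
  exists D : {freeg large_prime}, forall p, coeff p D = f p.
Proof.
move=> fN; pose s : seq large_prime := pmap insub (iota 0 N.+1).
exists (\sum_(q <- s) Freeg [:: (f q, q)])%R => p.
rewrite (raddf_sum (coeff p)) /=.
under eq_bigr do rewrite coeffU.
case: (leqP (val p) N) => pN.
  rewrite (bigD1_seq p) /=; last 2 first.
  - by rewrite mem_pmap_sub mem_iota /= add0n ltnS.
  - by apply: pmap_sub_uniq; exact: iota_uniq.
  rewrite eqxx GRing.mulr1 big1 ?GRing.addr0 // => q /negbTE ->.
  by rewrite GRing.mulr0.
rewrite fN // big1 // => q _; case: eqP => [->|_]; last by rewrite GRing.mulr0.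
by rewrite fN // GRing.mul0r.
Qed.

Variables (G : groupType) (C : set G) (phi : G -> {freeg large_prime}).
Hypothesis sC : is_subgroup C.
Hypothesis phiM : forall x y, C x -> C y -> phi (x * y) = (phi x + phi y)%R.

Lemma phi_multiple c (k : int) : C c -> exists2 x, C x & phi x = (phi c *~ k)%R.
Proof.
have [C1 CM CV] := sC; move=> Cc.
have p1 : phi 1 = 0%R.
  by have := phiM C1 C1; rewrite mulg1 => /eqP; rewrite -GRing.subr_eq GRing.subrr => /eqP.
have pX n : C (c ^+ n) /\ phi (c ^+ n) = (phi c *+ n)%R.
  elim: n => [|n [Cn IH]]; first by rewrite expg0 p1.
  by rewrite expgS; split; [exact: CM|rewrite phiM // IH GRing.mulrS].
case: k => n; first by exists (c ^+ n); [case: (pX n)|case: (pX n)].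
have [Cn En] := pX n.+1.
exists (c ^+ n.+1)^-1; first exact: CV.
apply: (@GRing.addrI _ (phi (c ^+ n.+1))).
rewrite -phiM // ?mulgV ?p1; last exact: CV.
by rewrite En NegzE mulrNz GRing.subrr.
Qed.

(** The image contains a family that is triangular with -1 on the diagonal: the
    coefficient of D at the largest prime of its support is removed by a
    multiple of the corresponding element, and one proceeds downwards. *)
Lemma triangular_surjective :
  (forall p : large_prime, exists2 c, C c &
    coeff p (phi c) = (-1)%R /\
    forall q : large_prime, (val p < val q)%N -> coeff q (phi c) = 0%R) ->
  forall D, exists2 c, C c & phi c = D.
Proof.
move=> tri; have [C1 CM CV] := sC.
suff H N D : (forall p : large_prime, (N <= val p)%N -> coeff p D = 0%R) ->
    exists2 c, C c & phi c = D.
  move=> D; apply: (H (\max_(p <- dom D) val p).+1) => p.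
  move=> pD; apply: coeff_outdom; apply: contraL pD => pD; rewrite -ltnNge ltnS.
  exact: leq_bigmax_seq.
elim: N D => [|N IH] D ND.
  have -> : D = 0%R by apply/eqP/freeg_eqP => p; rewrite ND // coeff0.
  by have [c Cc E] := @phi_multiple 1 0 C1; exists c => //; rewrite E mulr0z.
case: (boolP (prime N && (4 < N)%N)) => [pN|npN]; last first.
  apply: IH => p; rewrite leq_eqVlt => /orP[/eqP pE|/ND//].
  by case: p pE => q /= qP qE; move: npN; rewrite qE qP.
pose p : large_prime := exist _ N pN.
have [c Cc [c1 c0]] := tri p.
have [x Cx xE] := phi_multiple (coeff p D) Cc.
have [y Cy yE] : exists2 y, C y & phi y = (D + phi x)%R.
  apply: IH => q; rewrite leq_eqVlt => /orP[/eqP qE|qN]; rewrite coeffD xE.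
    have -> : q = p by apply/val_inj.
    by rewrite raddfMz /= c1 mulNrz intz GRing.subrr.
  by rewrite raddfMz /= c0 // mul0rz ND.
exists (y * x^-1); first by apply: CM => //; exact: CV.
apply: (@GRing.addIr _ (phi x)); rewrite -yE -phiM //.
  by rewrite mulgVK.
by apply: CM => //; exact: CV.
Qed.

End TriangularFamilies.
(** * Sections of local systems on a tree *)

Section TreeSections.
Variables (V : choiceType) (e : rel V).
Hypothesis tree : is_tree e.

Lemma tree_sym : symmetric e. Proof. by case: tree. Qed.
Lemma tree_irr : irreflexive e. Proof. by case: tree. Qed.

Lemma tree_ind (P : V -> Prop) v0 :
  P v0 -> (forall v w, e v w -> P v -> P w) -> forall v, P v.
Proof.
move=> P0 Pe v; have [_ _ _ /(_ v0 v) [p ep <-] _] := tree.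
elim: p v0 P0 ep => [//|w p IH] v0 P0 /= /andP[ew ep].
by apply: IH => //; exact: Pe ew P0.
Qed.

(** Where two simple paths with the same ends branch off, following one of them
    up to the first vertex of the other and coming back makes a circuit. *)
Lemma tree_uniq_path x p q :
  path e x p -> path e x q -> uniq (x :: p) -> uniq (x :: q) ->
  last x p = last x q -> p = q.
Proof.
have [_ _ _ _ acyc] := tree.
elim: p x q => [|a p IH] x q.
  case: q => // b q _ _ _ /= /andP[xq _] xl.
  by move: xq; rewrite xl mem_last.
case: q => [|b q].
  by move=> _ _ /= /andP[xp _] _ xl; move: xp; rewrite -xl mem_last.
move=> ep eq up uq lpq.
have [ab|ab] := eqVneq a b.
  move: ep eq up uq; rewrite -ab /= => /andP[_ ep] /andP[_ eq] /andP[_ up] /andP[_ uq].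
  by congr cons; apply: (IH a) => //; move: lpq; rewrite /= -ab.
have hq : has (mem (a :: p)) (b :: q).
  apply/hasP; exists (last b q); first exact: mem_last.
  by move: lpq => /= <-; exact: mem_last.
have [z [q1 [q2 [qE zp nq1]]]] : exists z q1 q2,
    [/\ b :: q = q1 ++ z :: q2, z \in a :: p & ~~ has (mem (a :: p)) q1].
  by case/split_find: hq => z q1 q2 zp nq1; exists z, q1, q2; rewrite cat_rcons.
have [p1 [p2 pE]] : exists p1 p2, a :: p = p1 ++ z :: p2.
  by case/splitPr: zp => p1 p2; exists p1, p2.
pose c := x :: p1 ++ z :: rev q1.
(* the two branches out of x and their first meeting point z form a circuit *)
suff : ucycle e c.
  move=> /acyc; rewrite /= size_cat /= size_rev => c2.
  have [/size0nil p10 /size0nil q10] : size p1 = 0 /\ size q1 = 0 by move: c2; lia.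
  move: pE qE; rewrite p10 q10 => -[az _] [bz _].
  by move: ab; rewrite az bz eqxx.
move: ep eq up uq nq1; rewrite pE qE !cons_uniq => ep eq /andP[xp up] /andP[xq uq] nq1.
apply/andP; split.
  rewrite /c /= rcons_cat cat_path /=.
  move: ep; rewrite cat_path /= => /andP[-> /andP[-> _]] /=.
  move: eq; rewrite -cat_rcons cat_path => /andP[eq _].
  have := rev_path e x (rcons q1 z).
  rewrite last_rcons belast_rcons rev_cons => ->.
  by apply: sub_path eq => u v; rewrite tree_sym.
rewrite /c cons_uniq mem_cat in_cons mem_rev.
move: xp xq; rewrite !mem_cat !in_cons !negb_or => /and3P[-> -> _] /and3P[-> _ _] /=.
rewrite cat_uniq /= mem_rev rev_uniq negb_or.
move: up; rewrite cat_uniq /= !negb_or => /and4P[-> /andP[-> _] _ _] /=.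
move: uq; rewrite cat_uniq /= !negb_or => /and4P[-> /andP[-> _] _ _].
rewrite !andbT /=; apply: contra nq1 => /hasP[y]; rewrite mem_rev => yq yp.
by apply/hasP; exists y => //=; rewrite mem_cat; move: yp => /= ->.
Qed.

Lemma tree_uniq_path_exists x y :
  exists p, [/\ path e x p, uniq (x :: p) & last x p = y].
Proof.
have [_ _ _ /(_ x y) [p ep <-] _] := tree.
by case/shortenP: ep => p' ep' up' _; exists p'.
Qed.

(** A local system: the fibre over v is P v, inside a fixed type D, and theta v w
    identifies the fibres over the ends of the edge from v to w. *)

Variables (D : Type) (P : V -> D -> Prop) (theta : V -> V -> D -> D).
Hypothesis thetaP : forall v w x, e v w -> P v x -> P w (theta v w x).
Hypothesis thetaK : forall v w x, e v w -> P v x -> theta w v (theta v w x) = x.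

Definition is_section (f : V -> D) :=
  (forall v, P v (f v)) /\ forall v w, e v w -> f w = theta v w (f v).

Fixpoint transport v (p : seq V) (x : D) : D :=
  if p is w :: p' then transport w p' (theta v w x) else x.

Lemma transportP v p x : path e v p -> P v x -> P (last v p) (transport v p x).
Proof.
elim: p v x => [//|w p IH] v x /= /andP[ew ep] Px.
by apply: IH => //; exact: thetaP.
Qed.

Lemma transport_rcons v p w x :
  transport v (rcons p w) x = theta (last v p) w (transport v p x).
Proof. by elim: p v x => [//|u p IH] v x /=; rewrite IH. Qed.

(** The element x0 is carried along the simple path to each vertex. For an edge,
    the simple path to one end is the simple path to the other end followed by
    the edge. *)
Lemma section_exists v0 x0 : P v0 x0 ->
  exists2 f, is_section f & f v0 = x0.
Proof.
move=> P0.
pose geo v := projT1 (cid (tree_uniq_path_exists v0 v)).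
have geoP v : [/\ path e v0 (geo v), uniq (v0 :: geo v) & last v0 (geo v) = v].
  exact: projT2 (cid (tree_uniq_path_exists v0 v)).
have geo_uniq v p : path e v0 p -> uniq (v0 :: p) -> last v0 p = v -> geo v = p.
  move=> ep up lp; have [eg ug lg] := geoP v.
  by apply: (tree_uniq_path (x := v0)) => //; rewrite lg lp.
pose f v := transport v0 (geo v) x0.
have fP v : P v (f v).
  have [eg _ lg] := geoP v; rewrite -[v in P v]lg /f; exact: transportP.
have step v w : e v w -> w \notin v0 :: geo v -> f w = theta v w (f v).
  move=> vw wN; have [eg ug lg] := geoP v.
  rewrite /f (@geo_uniq w (rcons (geo v) w)).
  - by rewrite transport_rcons lg.
  - by rewrite rcons_path eg lg.
  - by rewrite -rcons_cons rcons_uniq wN.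
  - by rewrite last_rcons.
exists f; last by rewrite /f (@geo_uniq v0 [::]).
split=> // v w vw.
case: (boolP (w \in v0 :: geo v)) => [wg|]; last exact: step.
suff vN : v \notin v0 :: geo w.
  have wv : e w v by rewrite tree_sym.
  by rewrite (step w v) // thetaK.
have [eg ug lg] := geoP v.
have vw' : v != w by apply: contraTneq vw => ->; rewrite tree_irr.
case/splitPl: wg eg ug lg => p1 p2 lp1; rewrite cat_path lp1 last_cat lp1 -cat_cons cat_uniq.
move=> /andP[e1 _] /and3P[u1 dis _] lp2.
rewrite (@geo_uniq w p1) //; apply: contra dis => vp1.
apply/hasP; exists v => //.
case: p2 lp2 => [wv|a p2 /= <-]; last exact: mem_last.
by move: vw'; rewrite -wv eqxx.
Qed.

Lemma section_unique f g v0 : is_section f -> is_section g -> f v0 = g v0 -> f = g.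
Proof.
move=> [_ ef] [_ eg] fg0; apply/funext; apply: (tree_ind fg0) => v w vw fgv.
by rewrite (ef _ _ vw) (eg _ _ vw) fgv.
Qed.

End TreeSections.
Section SectionStabilisers.
Local Open Scope group_scope.
Variables (V : choiceType) (e : rel V).
Hypothesis tree : is_tree e.
Variables (D : choiceType) (P : V -> set D) (theta : V -> V -> D -> D).
Variables (H : set (Sym V)) (act : Sym V -> D -> D).
Hypotheses (sH : is_subgroup H) (Haut : H `<=` graph_aut e).
Hypothesis act1 : forall x, act 1 x = x.
Hypothesis actM : forall h k x, H h -> H k -> act (h * k) x = act h (act k x).
Hypothesis actP : forall h v x, H h -> P v x -> P (h v) (act h x).
Hypothesis act_theta : forall h v w x, H h -> e v w -> P v x ->
  theta (h v) (h w) (act h x) = act h (theta v w x).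

Definition section_stabiliser (f : V -> D) : set (Sym V) :=
  [set h | H h /\ forall v, f (h v) = act h (f v)].

Lemma is_subgroup_section_stabiliser f : is_subgroup (section_stabiliser f).
Proof.
have [H1 HM HV] := sH; split.
- by split=> // v; rewrite act1.
- move=> h k [Hh fh] [Hk fk]; split; first exact: HM.
  by move=> v; rewrite symM_E fh fk actM.
- move=> h [Hh fh]; have Hh' := HV _ Hh; split => // v.
  have := fh (h^-1 v); rewrite symVK => ->.
  by rewrite -actM // mulVg act1.
Qed.

(** H permutes the sections, which are determined by their values in the finite
    fibre over v0. *)
Lemma finite_index_section_stabiliser f v0 :
  is_section e P theta f -> finite_set (P v0) ->
  finite_index (section_stabiliser f) H.
Proof.
move=> fs fin; have [H1 HM HV] := sH; have [fP ft] := fs.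
pose tf (h : Sym V) v := act h (f (h^-1 v)).
have tfs h : H h -> is_section e P theta (tf h).
  move=> Hh; have Hh' := HV _ Hh; split=> [v|v w vw].
    by have := actP Hh (fP (h^-1 v)); rewrite symVK.
  have hvw : e (h^-1 v) (h^-1 w) by rewrite (Haut Hh').
  by rewrite /tf (ft _ _ hvw) -act_theta // !symVK.
apply: (@finite_index_fun _ _ (fun h => tf h v0)).
- exact: is_subgroup_section_stabiliser.
- apply: sub_finite_set fin => _ [h Hh <-].
  by case: (tfs h Hh) => + _; apply.
- move=> h k Hh Hk E; have Hh' := HV _ Hh.
  have {}E : tf h = tf k by exact: (section_unique tree (tfs h Hh) (tfs k Hk) E).
  split=> [|v]; first exact: HM.
  have := congr1 (fun q => act h^-1 (q (k v))) E.
  by rewrite /tf -!actM ?mulVg ?act1 ?symK //; exact: HM.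
Qed.

End SectionStabilisers.
(** * Legal colourings of the edges *)

Section Colorings.
Local Open Scope group_scope.
Variables (V : choiceType) (e : rel V) (d : nat).
Hypothesis regular : is_regular_tree e d.

Let tree : is_tree e. Proof. by case: regular. Qed.

(** A colouring of the edges such that every colour occurs once at every vertex,
    encoded by the neighbour n v i of v along the edge of colour i: the group of
    the colouring then consists of the permutations that commute with n. *)
Definition legal (n : V -> 'I_d -> V) :=
  [/\ forall v i, e v (n v i), forall v, injective (n v),
      forall v w, e v w -> exists i, n v i = w & forall v i, n (n v i) i = v].

(** The edges at each vertex are numbered, and the two ends of an edge may
    disagree on its number. *)
Definition labelling (n : V -> 'I_d -> V) :=
  [/\ forall v i, e v (n v i), forall v, injective (n v) &
      forall v w, e v w -> exists i, n v i = w].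

Lemma legal_labelling n : legal n -> labelling n. Proof. by case. Qed.

Lemma labelling_exists : exists n, labelling n.
Proof.
have H v : exists f : 'I_d -> V, [/\ forall i, e v (f i), injective f &
    forall w, e v w -> exists i, f i = w].
  have [_ /(_ v) /card_set_bijP [g [gim ginj gsurj]]] := regular.
  have gv w : e v w -> (g w < d)%N by move=> vw; exact: gim.
  pose f (i : 'I_d) : V := xget v [set w | e v w /\ g w = i].
  have fP i : e v (f i) /\ g (f i) = i.
    apply: (@xgetPex _ v [set w | e v w /\ g w = i]).
    by have [w vw wi] := gsurj i (ltn_ord i); exists w.
  exists f; split.
  - by move=> i; case: (fP i).
  - by move=> i j fij; apply/val_inj; rewrite /= -(fP i).2 fij (fP j).2.
  - move=> w vw; exists (Ordinal (gv w vw)).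
    apply: ginj; rewrite ?inE //=; first by case: (fP (Ordinal (gv w vw))).
    by case: (fP (Ordinal (gv w vw))).
exists (fun v => projT1 (cid (H v))).
by split=> v; case: (projT2 (cid (H v))).
Qed.

Section Labels.
Variables (n : V -> 'I_d -> V).
Hypothesis ln : labelling n.

Definition label (i0 : 'I_d) v w : 'I_d := xget i0 [set i | n v i = w].

Lemma labelK i0 v w : e v w -> n v (label i0 v w) = w.
Proof.
move=> vw; apply: (@xgetPex _ i0 [set i | n v i = w]).
by case: ln => _ _ /(_ v w vw).
Qed.

Lemma label_n i0 v i : label i0 v (n v i) = i.
Proof. by case: ln => H /(_ v) inj _; apply: inj; rewrite labelK. Qed.

End Labels.

Lemma label_sym n (i0 : 'I_d) v w : legal n -> e v w -> label n i0 w v = label n i0 v w.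
Proof.
move=> ln vw; have wv : e w v by rewrite (tree_sym tree).
have ll := legal_labelling ln; have [n1 n2 n3 n4] := ln.
apply: (n2 w); rewrite (labelK ll i0 wv).
by have := n4 v (label n i0 v w); rewrite (labelK ll i0 vw).
Qed.

Definition colour_map (m n : V -> 'I_d -> V) (g : Sym V) :=
  forall v i, g (m v i) = n (g v) i.

Lemma colour_map_aut m n g : labelling m -> labelling n -> colour_map m n g ->
  graph_aut e g.
Proof.
move=> [m1 _ m3] [n1 n2 n3] gmn x y; apply/idP/idP => [gxy|xy].
  have [i] := n3 _ _ gxy; rewrite -gmn => gy.
  have := symK g y; rewrite -gy symK => <-; exact: m1.
by have [i <-] := m3 _ _ xy; rewrite gmn; exact: n1.
Qed.

Lemma colour_map_unique m n g h v0 : labelling m ->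
  colour_map m n g -> colour_map m n h -> g v0 = h v0 -> g = h.
Proof.
move=> [_ _ m3] gm hm gh0; apply: sym_inj.
apply: (tree_ind tree gh0) => v w vw gh.
by have [i <-] := m3 _ _ vw; rewrite gm hm gh.
Qed.

(** Two legally coloured copies of the tree are isomorphic, with any prescribed
    image of one vertex: the isomorphisms are the sections of a local system
    whose fibre is the vertex set. *)
Lemma colour_map_exists m n v0 w0 : (0 < d)%N -> legal m -> legal n ->
  exists2 g, colour_map m n g & g v0 = w0.
Proof.
move=> d0; pose i0 : 'I_d := Ordinal d0.
have ex (p q : V -> 'I_d -> V) x y : legal p -> legal q ->
    exists2 f : V -> V, (forall v i, f (p v i) = q (f v) i) & f x = y.
  move=> lp lq; have [p1 p2 p3 p4] := lp; have [q1 q2 q3 q4] := lq.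
  pose theta v w z := q z (label p i0 v w).
  have [||//|f [_ fs] fx] := @section_exists V e tree V (fun _ _ => True) theta _ _ x y.
  - by [].
  - by move=> v w z vw _; rewrite /theta (label_sym i0 lp vw) q4.
  exists f => // v i.
  by rewrite (fs v (p v i)) // /theta (label_n (legal_labelling lp)).
move=> lm ln; have [f fmn f0] := ex m n v0 w0 lm ln.
have [g gnm g0] := ex n m w0 v0 ln lm.
have [m1 m2 m3 m4] := lm; have [n1 n2 n3 n4] := ln.
have fK : cancel f g.
  apply: (tree_ind tree (v0 := v0)); first by rewrite f0 g0.
  by move=> v w /m3 [i <-] E; rewrite fmn gnm E.
have gK : cancel g f.
  apply: (tree_ind tree (v0 := w0)); first by rewrite g0 f0.
  by move=> v w /n3 [i <-] E; rewrite gnm fmn E.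
by exists (MkSym (Bijective fK gK)).
Qed.

Definition colour_group n : set (Sym V) := colour_map n n.

Lemma is_subgroup_colour_group n : is_subgroup (colour_group n).
Proof.
split=> // [g h gn hn v i|g gn v i].
  by rewrite !symM_E hn gn.
by apply: (can_inj (symK g)); rewrite symVK gn symVK.
Qed.

(** A labelling is made legal by composing it at each vertex with a permutation
    of the colours. For the two ends of each edge to agree, the permutations at
    neighbouring vertices may be chosen to differ by the transposition of the
    two labels of the edge; they are then the sections of a local system with
    fibre the symmetric group. *)
Lemma legal_correction n (i0 : 'I_d) : labelling n ->
  let theta (v w : V) (s : {perm 'I_d}) : {perm 'I_d} :=
    (tperm (label n i0 v w) (label n i0 w v) * s)%g in
  (exists f, is_section e (fun _ _ => True) theta f) /\
  forall f, is_section e (fun _ _ => True) theta f ->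
    legal (fun v i => n v ((f v)^-1%g i)).
Proof.
move=> ln theta; split.
  have [[v0] _ _ _ _] := tree.
  have [||//|f fs _] := @section_exists V e tree _ (fun _ _ => True) theta _ _ v0 1%g.
  - by [].
  - by move=> v w s vw _; rewrite /theta tpermC mulgA tperm2 mul1g.
  by exists f.
move=> f [_ fs]; have [n1 n2 n3] := ln.
split=> [v i|v i j|v w vw|v i].
- exact: n1.
- by move=> /n2 /perm_inj.
- by have [i <-] := n3 _ _ vw; exists (f v i); rewrite permK.
- set w := n v _; have vw : e v w by exact: n1.
  have -> : ((f w)^-1)%g i = label n i0 w v.
    apply: (canLR (permK (f w))).
    rewrite (fs _ _ vw) /theta permM tpermR /w label_n // permKV //.
  by rewrite labelK // tree_sym.
Qed.

(** A free action has an invariant labelling, obtained by transport from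
    representatives of the orbits of vertices. The group then acts on the finite
    set of legal corrections of this labelling. *)
Lemma free_periodic_colouring (H : set (Sym V)) : (0 < d)%N ->
  is_subgroup H -> H `<=` graph_aut e -> (forall h v, H h -> h v = v -> h = 1) ->
  exists2 n, legal n & finite_index (H `&` colour_group n) H.
Proof.
move=> d0 sH Haut free; have [H1 HM HV] := sH.
pose i0 : 'I_d := Ordinal d0.
have [[v0] _ _ _ _] := tree.
have [n0 [n01 n02 n03]] := labelling_exists.
have [rep [tr [Htr trE rep_inv]]] := @orbit_representatives (Sym V) V
  (fun h v => h v) H sH (fun v => erefl) (fun h k v => erefl).
have tr_inv h v : H h -> tr (h v) = h * tr v.
  move=> Hh; have E : (h * tr v)^-1 * tr (h v) = 1.
    apply: (free _ (rep v)).
      by apply: (HM) => //; apply: (HV); exact: HM.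
    rewrite symM_E -{1}(rep_inv h v Hh) trE.
    by apply: (can_inj (symK (h * tr v))); rewrite symVK symM_E trE.
  by rewrite -[LHS](mulVKg (h * tr v)) E mulg1.
pose n v i := tr v (n0 (rep v) i).
have aut h x y : H h -> e (h x) (h y) = e x y by move=> /Haut; apply.
have ln : labelling n.
  split=> [v i|v i j|v w vw].
  - by rewrite /n -{1}(trE v) aut.
  - by move=> /(can_inj (symK _)) /n02.
  - have [i iE] : exists i, n0 (rep v) i = (tr v)^-1 w.
      by apply: n03; rewrite -(aut (tr v)) // trE symVK.
    by exists i; rewrite /n iE symVK.
have n_inv h v i : H h -> n (h v) i = h (n v i).
  by move=> Hh; rewrite /n rep_inv // tr_inv.
have lab_inv h v w : H h -> e v w -> label n i0 (h v) (h w) = label n i0 v w.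
  move=> Hh vw; have [_ inj _] := ln; apply: (inj (h v)).
  by rewrite labelK ?aut // n_inv // labelK.
have [[f fs] legalf] := legal_correction i0 ln.
pose nn v i := n v ((f v)^-1%g i).
exists nn; first exact: legalf.
have fin : finite_index (section_stabiliser H (fun=> id) f) H.
  apply: (finite_index_section_stabiliser tree sH Haut _ _ _ _ fs (v0 := v0)) => //.
    by move=> h v w s Hh vw _; rewrite !lab_inv // tree_sym.
  exact: finite_finset.
have sK := @is_subgroup_section_stabiliser V _ H (fun=> id) sH
  (fun=> erefl) (fun _ _ _ _ _ => erefl) f.
apply: finite_indexS sK _ fin.
  by apply: is_subgroupI => //; exact: is_subgroup_colour_group.
by move=> h [Hh fh]; split=> // v i; rewrite /nn fh n_inv.
Qed.

Lemma legal_exists : (0 < d)%N -> exists n, legal n.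
Proof.
move=> d0; have [||h v -> //|n ln _] := @free_periodic_colouring [set 1] d0.
- split=> // [x y -> ->|x ->]; [exact: mulg1|exact: invg1].
- by move=> h -> x y.
by exists n.
Qed.

End Colorings.
(** * Free actions of finite groups *)

Section FreeActions.
Local Open Scope group_scope.
Local Notation card A := (#|` fset_set A|)%fset.

Lemma card_uniq_seq (T : choiceType) (A : set T) (s : seq T) :
  uniq s -> (forall x, A x <-> x \in s) -> card A = size s.
Proof.
move=> us As.
have finA : finite_set A by apply/finite_seqP; exists s; apply/seteqP; split=> x /As.
apply: perm_size; apply: uniq_perm => // x.
rewrite in_fset_set //; apply/idP/idP => [/set_mem /As //|xs].
by apply/mem_set/As.
Qed.

Lemma card_image_inj (T U : choiceType) (f : T -> U) (A : set T) :
  finite_set A -> (forall x y, A x -> A y -> f x = f y -> x = y) ->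
  card (f @` A) = card A.
Proof.
move=> finA finj; pose s := enum_fset (fset_set A).
have sA x : x \in s <-> A x.
  by rewrite /s in_fset_set //; split=> [/set_mem|/mem_set].
rewrite (@card_uniq_seq _ _ (map f s)) ?size_map //.
  rewrite map_inj_in_uniq ?fset_uniq // => x y /sA Ax /sA Ay; exact: finj.
move=> y; split=> [[x /sA xs <-]|/mapP[x /sA Ax ->]]; first exact: map_f.
by exists x.
Qed.

Lemma card_setX (T U : choiceType) (A : set T) (B : set U) :
  finite_set A -> finite_set B -> card (A `*` B) = (card A * card B)%N.
Proof.
move=> finA finB.
rewrite -(size_allpairs (fun x y => (x, y))); apply: card_uniq_seq.
  by apply: allpairs_uniq => [||[x y] [z t] _ _ //]; exact: fset_uniq.
move=> [x y]; split=> [[/= Ax By]|/allpairsP[[u v] /= [uA vB [-> ->]]]].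
  apply/allpairsP; exists (x, y); split=> //=; rewrite in_fset_set //; exact/mem_set.
by split=> /=; [move: uA|move: vB]; rewrite in_fset_set // => /set_mem.
Qed.

Lemma card_subset_eq (T : choiceType) (A B : set T) :
  finite_set B -> A `<=` B -> card A = card B -> A = B.
Proof.
move=> finB AB cAB; have finA := sub_finite_set AB finB.
apply: fset_set_inj => //; apply/eqP; rewrite eqEfcard cAB leqnn andbT.
by rewrite -fset_set_sub.
Qed.

Lemma card_le_injection (T U : choiceType) (u0 : U) (A : set T) (B : set U) :
  finite_set A -> finite_set B -> (card A <= card B)%N ->
  exists b : T -> U, (forall x, A x -> B (b x)) /\
    forall x y, A x -> A y -> b x = b y -> x = y.
Proof.
move=> finA finB AB.
pose s := enum_fset (fset_set A); pose t := enum_fset (fset_set B).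
have sA x : A x -> x \in s by move=> Ax; rewrite /s in_fset_set //; exact/mem_set.
have lt x : A x -> (index x s < size t)%N.
  by move=> /sA xs; apply: leq_trans AB; rewrite index_mem.
exists (fun x => nth u0 t (index x s)); split=> [x Ax|x y Ax Ay /eqP].
  have := mem_nth u0 (lt x Ax); rewrite in_fset_set // => /set_mem //.
rewrite nth_uniq ?lt ?fset_uniq // => /eqP E.
by rewrite -(nth_index x (sA x Ax)) E nth_index // sA.
Qed.

Section FreeSets.
Variables (G : groupType) (X : choiceType) (act : G -> X -> X) (S : set G).
Hypothesis sS : is_subgroup S.
Hypothesis act1 : forall x, act 1 x = x.
Hypothesis actM : forall h k x, act (h * k) x = act h (act k x).
Hypothesis free : forall h x, act h x = x -> h = 1.

Definition equivariant_bijection (P Q : set X) (f g : X -> X) :=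
  [/\ forall x, P x -> Q (f x) /\ g (f x) = x,
      forall y, Q y -> P (g y) /\ f (g y) = y,
      forall h x, S h -> P x -> f (act h x) = act h (f x) &
      forall h y, S h -> Q y -> g (act h y) = act h (g y)].

Section Representatives.
Variables (rep : X -> X) (tr : X -> G).
Hypothesis Str : forall x, S (tr x).
Hypothesis trE : forall x, act (tr x) (rep x) = x.
Hypothesis rep_inv : forall h x, S h -> rep (act h x) = rep x.
Let reps (P : set X) := [set x | P x /\ rep x = x].

(** An injection between the sets of orbit representatives extends uniquely to
    an equivariant injection, which is onto because the two sets have the same
    finite size. *)
Lemma free_sets_isomorphic_le (x0 : X) (P Q : set X) :
  (forall h x, S h -> P x -> P (act h x)) ->
  (forall h x, S h -> Q x -> Q (act h x)) ->
  finite_set P -> finite_set Q -> card P = card Q -> (card (reps P) <= card (reps Q))%N ->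
  exists f g, equivariant_bijection P Q f g.
Proof.
move=> SP SQ finP finQ PQ le_reps; have [S1 SM SV] := sS.
have finreps R : finite_set R -> finite_set (reps R).
  by apply: sub_finite_set => x [].
have [b [b_fun b_inj]] := card_le_injection x0 (finreps _ finP) (finreps _ finQ) le_reps.
have actK h x : act h^-1 (act h x) = x by rewrite -actM mulVg act1.
have act_inj h k x : act h x = act k x -> h = k.
  move=> E; have : act (k^-1 * h) x = x by rewrite actM E actK.
  by move=> /free E'; rewrite -[LHS](mulVKg k) E' mulg1.
have tr_inv h x : S h -> tr (act h x) = h * tr x.
  move=> Sh; apply: (@act_inj _ _ (rep x)).
  by rewrite actM trE -{1}(rep_inv x Sh) trE.
have rep_reps x : P x -> reps P (rep x).
  move=> Px; have rE : rep x = act (tr x)^-1 x by rewrite -[LHS](actK (tr x)) trE.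
  by split; [rewrite rE; apply: SP => //; exact: SV|rewrite {1}rE rep_inv //; exact: SV].
pose f x := act (tr x) (b (rep x)).
have bQ x : P x -> reps Q (b (rep x)) by move=> /rep_reps /b_fun.
have fQ x : P x -> Q (f x).
  by move=> /bQ [Qb _]; exact: SQ.
have f_eq h x : S h -> P x -> f (act h x) = act h (f x).
  by move=> Sh Px; rewrite /f tr_inv // actM rep_inv.
have f_inj x y : P x -> P y -> f x = f y -> x = y.
  move=> Px Py fxy; have rxy : rep x = rep y.
    apply: b_inj; [exact: rep_reps|exact: rep_reps|].
    by have := congr1 rep fxy; rewrite /f !rep_inv // (bQ x Px).2 (bQ y Py).2.
  move: fxy; rewrite /f rxy => /act_inj txy.
  by rewrite -(trE x) -(trE y) txy rxy.
have f_surj y : Q y -> exists2 x, P x & f x = y.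
  have -> : Q = f @` P.
    apply/esym/card_subset_eq => //; first by move=> _ [x Px <-]; exact: fQ.
    by rewrite card_image_inj.
  by [].
pose g y := xget y [set x | P x /\ f x = y].
have gP y : Q y -> P (g y) /\ f (g y) = y.
  move=> Qy; apply: (@xgetPex _ y [set x | P x /\ f x = y]).
  by have [x Px fx] := f_surj y Qy; exists x.
have gf x : P x -> g (f x) = x.
  by move=> Px; have [Pg fg] := gP _ (fQ x Px); exact: f_inj.
exists f, g; split=> // [x Px|h y Sh Qy]; first by split; [exact: fQ|exact: gf].
have [Pg fg] := gP y Qy.
by rewrite -{1}fg -f_eq // gf //; exact: SP.
Qed.

End Representatives.

(** Counting orbits is avoided: one of the two sets of representatives injects
    into the other. *)
Lemma free_sets_isomorphic (x0 : X) (P Q : set X) :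
  (forall h x, S h -> P x -> P (act h x)) ->
  (forall h x, S h -> Q x -> Q (act h x)) ->
  finite_set P -> finite_set Q -> card P = card Q ->
  exists fg, equivariant_bijection P Q fg.1 fg.2.
Proof.
move=> SP SQ finP finQ PQ.
have [rep [tr [Str trE rep_inv]]] := orbit_representatives sS act1 actM.
pose reps (R : set X) := [set x | R x /\ rep x = x].
case: (leqP (card (reps P)) (card (reps Q))) => [le|/ltnW le].
  have [f [g fgE]] := free_sets_isomorphic_le Str trE rep_inv x0 SP SQ finP finQ PQ le.
  by exists (f, g).
have [f [g [H1 H2 H3 H4]]] := free_sets_isomorphic_le Str trE rep_inv x0 SQ SP finQ finP (esym PQ) le.
by exists (g, f).
Qed.

End FreeSets.
End FreeActions.
(** * Subgroups of finite index that act freely *)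

Section FreeSubgroup.
Local Open Scope group_scope.
Local Notation card A := (#|` fset_set A|)%fset.
Variables (V : choiceType) (e : rel V).
Hypothesis tree : is_tree e.

Definition vertex_stabiliser (H : set (Sym V)) v := [set h | H h /\ h v = v].

Lemma tree_bipartition : exists eps : V -> bool, forall v w, e v w -> eps w = ~~ eps v.
Proof.
have [[v0] _ _ _ _] := tree.
have [||//|f [_ fs] _] := @section_exists V e tree bool (fun _ _ => True) (fun _ _ => negb) _ _ v0 true.
- by [].
- by move=> v w b _ _; exact: negbK.
by exists f.
Qed.

(** The group H acts freely on Sym V * nat by left multiplication. Over each
    vertex v is placed a finite subset of constant size, stable under the
    stabiliser of v. The stabiliser of an edge acts freely on the sets over its
    two ends, so these are isomorphic, and a choice of isomorphisms for
    representatives of the edges extends equivariantly to all edges. An element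
    of H that fixes a section of the resulting local system and a vertex v fixes
    the value at v, so it is 1. The bipartition eps prevents inversions of
    edges, which could forbid a choice compatible with both directions. *)
Section Bipartite.
Variables (H : set (Sym V)) (N : nat) (eps : V -> bool).
Hypotheses (sH : is_subgroup H) (Haut : H `<=` graph_aut e).
Hypothesis stab_fin : forall v, finite_set (vertex_stabiliser H v).
Hypothesis stab_le : forall v, (card (vertex_stabiliser H v) <= N)%N.
Hypothesis eps_edge : forall v w, e v w -> eps w = ~~ eps v.
Hypothesis eps_inv : forall h v, H h -> eps (h v) = eps v.

Let H1 : H 1. Proof. by case: sH. Qed.
Let HM h k : H h -> H k -> H (h * k). Proof. by case: sH => _ + _; apply. Qed.
Let HV h : H h -> H h^-1. Proof. by case: sH => _ _; apply. Qed.

Let aut h x y : H h -> e (h x) (h y) = e x y.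
Proof. by move=> /Haut; apply. Qed.

(* representatives of the orbits of vertices and of ordered pairs of vertices *)
Variables (rep : V -> V) (tr : V -> Sym V).
Hypothesis Htr : forall v, H (tr v).
Hypothesis trE : forall v, tr v (rep v) = v.
Hypothesis rep_inv : forall h v, H h -> rep (h v) = rep v.
Variables (rep2 : V * V -> V * V) (tr2 : V * V -> Sym V).
Hypothesis Htr2 : forall p, H (tr2 p).
Hypothesis tr2E : forall p, (tr2 p (rep2 p).1, tr2 p (rep2 p).2) = p.
Hypothesis rep2_inv : forall h p, H h -> rep2 (h p.1, h p.2) = rep2 p.

Definition left_mult (h : Sym V) (x : Sym V * nat) : Sym V * nat := (h * x.1, x.2).

Let left_mult1 x : left_mult 1 x = x. Proof. by case: x => x i; rewrite /left_mult mul1g. Qed.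
Let left_multM h k x : left_mult (h * k) x = left_mult h (left_mult k x).
Proof. by rewrite /left_mult /= mulgA. Qed.
Let left_mult_free h x : left_mult h x = x -> h = 1.
Proof. by case: x => x i [] hx; rewrite -[h](mulgK x) hx mulgV. Qed.

(** The elements that carry the orbit representative to v, in as many copies as
    are needed for a total of N! elements. *)
Definition fibre v : set (Sym V * nat) :=
  [set h | H h /\ h (rep v) = v] `*`
  `I_(N`! %/ card (vertex_stabiliser H (rep v))).

Let fibre_inv h v x : H h -> fibre v x -> fibre (h v) (left_mult h x).
Proof.
move=> Hh [[Hx xv] xi]; split; rewrite /= ?rep_inv //.
by split; [exact: HM|rewrite xv].
Qed.

Let transporter_card v :
  finite_set [set h | H h /\ h (rep v) = v] /\
  card [set h | H h /\ h (rep v) = v] = card (vertex_stabiliser H (rep v)).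
Proof.
have -> : [set k | H k /\ k (rep v) = v] =
    (fun k => tr v * k) @` vertex_stabiliser H (rep v).
  apply/seteqP; split=> [k [Hk kv]|_ [k [Hk kv] <-]].
    exists ((tr v)^-1 * k); last by rewrite mulVKg.
    split; first by apply: HM => //; exact: HV.
    by rewrite symM_E kv -{2}(trE v) symK.
  by split; [exact: HM|rewrite symM_E kv trE].
split; first exact: finite_image.
by rewrite card_image_inj // => x y _ _ /mulgI.
Qed.

Let fibre_finite v : finite_set (fibre v).
Proof.
by apply: finite_setX; [case: (transporter_card v)|exact: finite_II].
Qed.

Let fibre_card v : card (fibre v) = N`!.
Proof.
have [fin cE] := transporter_card v.
rewrite /fibre (card_setX fin (@finite_II _)).
rewrite cE (card_fset_set (card_eqxx `I__)) mulnC divnK //.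
apply: dvdn_fact; rewrite stab_le andbT cardfs_gt0.
apply/eqP => E; have : vertex_stabiliser H (rep v) 1 by [].
by move=> /mem_set; rewrite -in_fset_set // E.
Qed.

Let edge_data v w : e v w ->
  exists fg, equivariant_bijection left_mult
    (vertex_stabiliser H v `&` vertex_stabiliser H w) (fibre v) (fibre w) fg.1 fg.2.
Proof.
move=> vw; apply: (@free_sets_isomorphic _ _ left_mult _ _ left_mult1 left_multM
  left_mult_free (1, 0%N)) => //.
- apply: is_subgroupI; split=> //.
  + by move=> h k [Hh hv] [Hk kv]; split; [exact: HM|rewrite symM_E kv].
  + by move=> h [Hh hv]; split; [exact: HV|rewrite -{1}hv symK].
  + by move=> h k [Hh hv] [Hk kv]; split; [exact: HM|rewrite symM_E kv].
  + by move=> h [Hh hv]; split; [exact: HV|rewrite -{1}hv symK].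
- by move=> h x [[Hh hv] _] /(fibre_inv Hh); rewrite hv.
- by move=> h x [_ [Hh hv]] /(fibre_inv Hh); rewrite hv.
- by rewrite !fibre_card.
Qed.

Let rep2_edge v w : e v w -> e (rep2 (v, w)).1 (rep2 (v, w)).2.
Proof.
have [t1 t2] := tr2E (v, w).
by have := aut (rep2 (v, w)).1 (rep2 (v, w)).2 (Htr2 (v, w)); rewrite t1 t2 => <-.
Qed.

Let glue (p : V * V) : (Sym V * nat -> Sym V * nat) * (Sym V * nat -> Sym V * nat) :=
  if pselect (e p.1 p.2) is left vw then projT1 (cid (edge_data vw)) else (id, id).

Let glueP v w : e v w -> equivariant_bijection left_mult
  (vertex_stabiliser H v `&` vertex_stabiliser H w) (fibre v) (fibre w)
  (glue (v, w)).1 (glue (v, w)).2.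
Proof.
rewrite /glue => vw; case: pselect => // vw'.
exact: projT2 (cid (edge_data vw')).
Qed.

(* The bijections chosen at the representatives of the edges, moved to all
   edges; s selects the direction. *)
Let along (s : bool) v w x :=
  let t := tr2 (v, w) in let g := glue (rep2 (v, w)) in
  left_mult t ((if s then g.2 else g.1) (left_mult t^-1 x)).

Let fibre_back v w x :
  (fibre v x -> fibre (rep2 (v, w)).1 (left_mult (tr2 (v, w))^-1 x)) /\
  (fibre w x -> fibre (rep2 (v, w)).2 (left_mult (tr2 (v, w))^-1 x)).
Proof.
have [t1 t2] := tr2E (v, w); have Ht' := HV (Htr2 (v, w)).
split=> /(fibre_inv Ht'); first by rewrite -(canRL (symK _) t1).
by rewrite -(canRL (symK _) t2).
Qed.

Let left_multVK h x : left_mult h^-1 (left_mult h x) = x.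
Proof. by rewrite -left_multM mulVg left_mult1. Qed.
Let left_multKV h x : left_mult h (left_mult h^-1 x) = x.
Proof. by rewrite -left_multM mulgV left_mult1. Qed.

Let alongP v w : e v w ->
  (forall x, fibre v x -> fibre w (along false v w x) /\
     along true v w (along false v w x) = x) /\
  (forall x, fibre w x -> fibre v (along true v w x) /\
     along false v w (along true v w x) = x).
Proof.
move=> vw; have [t1 t2] := tr2E (v, w); have Ht := Htr2 (v, w).
have := glueP (rep2_edge vw); rewrite -surjective_pairing => -[g1 g2 _ _].
split=> x fx.
  have [/(_ fx) fr _] := fibre_back v w x.
  have [fg gg] := g1 _ fr; split.
    by rewrite -{1}t2; apply: fibre_inv.
  by rewrite /along /= left_multVK gg left_multKV.
have [_ /(_ fx) fr] := fibre_back v w x.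
have [fg gg] := g2 _ fr; split.
  by rewrite -{1}t1; apply: fibre_inv.
by rewrite /along /= left_multVK gg left_multKV.
Qed.

(* The transporters of an edge and of its translate by h differ from h by a
   stabiliser of the representative, with which the bijection commutes. *)
Let along_inv s h v w x : H h -> e v w -> fibre (if s then w else v) x ->
  along s (h v) (h w) (left_mult h x) = left_mult h (along s v w x).
Proof.
move=> Hh vw fx; have [t1 t2] := tr2E (v, w); have [t1' t2'] := tr2E (h v, h w).
have := glueP (rep2_edge vw); rewrite -surjective_pairing => -[_ _ g3 g4].
have rE : rep2 (h v, h w) = rep2 (v, w) by have := rep2_inv (v, w) Hh.
have [fv fw] := fibre_back v w x.
move: t1' t2' (Htr2 (h v, h w)); rewrite /along rE => t1' t2' Ht'.
have Ht := Htr2 (v, w).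
set t' := tr2 (h v, h w) in t1' t2' Ht' *; set t := tr2 (v, w) in t1 t2 Ht fv fw *.
pose k := t'^-1 * (h * t).
have kS : (vertex_stabiliser H (rep2 (v, w)).1 `&` vertex_stabiliser H (rep2 (v, w)).2) k.
  have Hk : H k by apply: HM; [exact: HV|exact: HM].
  split; split=> //; rewrite /k !symM_E.
    by rewrite t1 -t1' symK.
  by rewrite t2 -t2' symK.
have -> : left_mult t'^-1 (left_mult h x) = left_mult k (left_mult t^-1 x).
  by rewrite -!left_multM /k -!mulgA mulgV mulg1.
have kE y : left_mult t' (left_mult k y) = left_mult h (left_mult t y).
  by rewrite -!left_multM /k !mulgA mulgV mul1g.
case: s fx => fx /=; first by rewrite g4 //; exact: fw.
by rewrite g3 //; exact: fv.
Qed.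

Lemma bipartite_free_subgroup :
  exists H', [/\ is_subgroup H', H' `<=` H, finite_index H' H &
    forall h v, H' h -> h v = v -> h = 1].
Proof.
have [[v0] _ _ _ _] := tree.
pose theta v w x := if eps v then along true w v x else along false v w x.
have [x0 fx0] : exists x, fibre v0 x.
  have : card (fibre v0) != 0%N by rewrite fibre_card -lt0n fact_gt0.
  rewrite cardfs_eq0 => /fset0Pn [x]; rewrite in_fset_set // => /set_mem fx.
  by exists x.
have eT v w : e v w -> e w v by rewrite (tree_sym tree).
have thP v w x : e v w -> fibre v x ->
    fibre w (theta v w x) /\ theta w v (theta v w x) = x.
  move=> vw fx; rewrite /theta (eps_edge vw); case: (eps v) => /=.
    by have [_ H2] := alongP (eT _ _ vw); exact: H2.
  by have [H1' _] := alongP vw; exact: H1'.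
have [f fs _] := @section_exists V e tree _ fibre theta
  (fun v w x vw fx => (thP v w x vw fx).1) (fun v w x vw fx => (thP v w x vw fx).2)
  v0 x0 fx0.
have left_mult_theta h v w x : H h -> e v w -> fibre v x ->
    theta (h v) (h w) (left_mult h x) = left_mult h (theta v w x).
  move=> Hh vw fx; rewrite /theta eps_inv //; case: (eps v).
    by apply: along_inv => //; exact: eT.
  exact: along_inv.
exists (section_stabiliser H left_mult f); split.
- by apply: is_subgroup_section_stabiliser => // h k x _ _; exact: left_multM.
- by move=> h [].
- apply: (finite_index_section_stabiliser tree sH Haut left_mult1 _ _ left_mult_theta fs (v0 := v0)).
  + by move=> h k x _ _; exact: left_multM.
  + by move=> h v x; exact: fibre_inv.
  + exact: fibre_finite.
- move=> h v [Hh fh] hv; apply: (@left_mult_free _ (f v)).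
  by rewrite -fh hv.
Qed.

End Bipartite.

(** The elements that preserve the bipartition of the tree form a subgroup of
    index at most two, which reduces the statement to the bipartite case. *)
Lemma free_subgroup_exists (H : set (Sym V)) N :
  is_subgroup H -> H `<=` graph_aut e ->
  (forall v, finite_set (vertex_stabiliser H v)) ->
  (forall v, (card (vertex_stabiliser H v) <= N)%N) ->
  exists H', [/\ is_subgroup H', H' `<=` H, finite_index H' H &
    forall h v, H' h -> h v = v -> h = 1].
Proof.
move=> sH Haut fin le; have [eps epsE] := tree_bipartition.
have [[v0] _ _ _ _] := tree.
pose H0 := section_stabiliser H (fun _ (b : bool) => b) eps.
have sH0 : is_subgroup H0 by exact: is_subgroup_section_stabiliser.
have H0H : H0 `<=` H by move=> h [].
have fH0 : finite_index H0 H.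
  apply: (@finite_index_section_stabiliser V e tree bool (fun _ _ => True)
    (fun _ _ => negb) H (fun _ b => b) sH Haut _ _ _ _ eps v0) => //.
  exact: finite_finset.
have stabS v : vertex_stabiliser H0 v `<=` vertex_stabiliser H v.
  by move=> h [/H0H].
have [rep [tr [Htr trE rep_inv]]] := @orbit_representatives (Sym V) V
  (fun h v => h v) H0 sH0 (fun v => erefl) (fun h k v => erefl).
have [rep2 [tr2 [Htr2 tr2E rep2_inv]]] := @orbit_representatives (Sym V) (V * V)%type
  (fun h p => (h p.1, h p.2)) H0 sH0 (fun p => esym (surjective_pairing p))
  (fun h k p => erefl).
have [|||||H' [sH' H'H fH' freeH']] := @bipartite_free_subgroup H0 N eps sH0
  _ _ _ _ _ rep tr Htr trE rep_inv rep2 tr2 Htr2 tr2E rep2_inv.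
- by move=> h /H0H /Haut.
- by move=> v; exact: sub_finite_set (stabS v) (fin v).
- move=> v; apply: leq_trans (le v); apply: fsubset_leq_card.
  by rewrite -fset_set_sub //; exact: sub_finite_set (stabS v) (fin v).
- exact: epsE.
- by move=> h v [_ /(_ v)].
exists H'; split=> //; first by move=> h /H'H /H0H.
exact: finite_index_trans fH0 fH'.
Qed.

End FreeSubgroup.
(** * Leighton's theorem for lattices *)

Section Lattices.
Local Open Scope group_scope.
Local Notation card A := (#|` fset_set A|)%fset.
Variables (V : choiceType) (e : rel V) (d : nat) (Gamma : set (Sym V)).
Hypotheses (d_gt0 : (0 < d)%N) (regular : is_regular_tree e d).
Hypothesis lattice : cocompact_lattice Gamma (graph_aut e).

Let tree : is_tree e. Proof. by case: regular. Qed.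
Let sGamma : is_subgroup Gamma. Proof. by case: lattice => -[]. Qed.
Let Gaut : Gamma `<=` graph_aut e. Proof. by case: lattice => -[]. Qed.

Lemma aut_transitive v w : exists2 g, graph_aut e g & g v = w.
Proof.
have [n ln] := legal_exists regular d_gt0.
have [g gn gv] := colour_map_exists regular v w d_gt0 ln ln.
by exists g => //; apply: colour_map_aut gn; exact: legal_labelling.
Qed.

(** The cosets x Gamma for which a given u lies in the Gamma-orbit of x^-1 v0
    form an open set, and these sets cover the compact coset space. *)
Lemma cocompact_finite_orbits : exists s : seq V,
  forall v, exists2 u, u \in s & exists2 g, Gamma g & g u = v.
Proof.
have [[v0] _ _ _ _] := tree; have [_ cpt] := lattice.
have aut1 : graph_aut e 1 by move=> x y.
pose X := coset_space (graph_aut e) Gamma.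
pose pX : ptopologicalType := HB.pack X
  (isPointed.Build X (coset_proj (graph_aut e) Gamma (exist _ 1 (mem_set aut1)))).
pose f u : set X := [set A : X | exists2 x : Sym V, (set_val A : set (Sym V)) x & x u = v0].
have : cover_compact [set: pX] by rewrite -compact_cover; exact: cpt.
move=> /(_ V setT f)[].
- move=> u _; suff : coset_open (f u) by []; rewrite /coset_open.
  have -> : coset_proj (graph_aut e) Gamma @^-1` f u =
      set_val @^-1` [set x : Sym V | exists2 g, Gamma g & x (g u) = v0].
    apply/seteqP; split=> [h [x [g Gg <-] xu]|h [g Gg hg]]; first by exists g.
    by exists (set_val h * g) => //; exists g.
  apply: open_comp; first by move=> x _; exact: initial_continuous.
  have -> : [set x : Sym V | exists2 g, Gamma g & x (g u) = v0] =
      \bigcup_(g in Gamma) [set x : Sym V | (fun y => y = v0) (x (g u))].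
    by apply/seteqP; split=> x [g Gg xg]; exists g.
  by apply: bigcup_open => g _; exact: (@open_eval _ (g u) (fun y => y = v0)).
- move=> A _.
  have [x Gx xA] := set_valP A.
  exists (x^-1 v0) => //; exists x; last exact: symVK.
  have : left_coset x Gamma x by apply/left_cosetP; rewrite mulVg; case: sGamma.
  by rewrite xA.
move=> s _ cov; exists s => v.
have [x Gx xv] := aut_transitive v v0.
have [u us [y [g Gg <-] yu]] := cov (coset_proj (graph_aut e) Gamma (exist _ x (mem_set Gx))) I.
exists u => //; exists g => //.
by apply: (can_inj (symK x)); rewrite xv.
Qed.

Lemma finite_neighbours v : finite_set [set w | e v w].
Proof. by have [_ /(_ v) H] := regular; exists d. Qed.

Lemma finite_path_ends v k : finite_set [set last v p | p in [set p | path e v p /\ size p = k]].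
Proof.
elim: k v => [|k IH] v.
  apply: sub_finite_set (finite_set1 v) => _ [p [_ /size0nil ->] <-] //.
apply: (@sub_finite_set _ _ (\bigcup_(w in [set w | e v w])
    [set last w p | p in [set p | path e w p /\ size p = k]])).
  move=> _ [[|w p] [//= /andP[vw ep] [sp]] <-].
  by exists w => //; exists p.
by apply: bigcup_finite; [exact: finite_neighbours|move=> w _; exact: IH].
Qed.

(** The image of a path from v to x starts at v and has the same length. *)
Lemma finite_stabiliser_orbit v x : finite_set [set g x | g in vertex_stabiliser Gamma v].
Proof.
have [_ _ _ /(_ v x) [p ep px] _] := tree.
apply: sub_finite_set (finite_path_ends v (size p)) => _ [g [Gg gv] <-].
exists (map g p); last by rewrite -{1}gv last_map px.
split; last exact: size_map.
rewrite -{1}gv path_map; apply: sub_path ep => u w uw.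
by rewrite /= (Gaut Gg).
Qed.

(** The identity is isolated in Gamma, and its neighbourhoods are given by
    finitely many vertices. *)
Lemma discrete_faithful : exists L : seq V,
  forall g, Gamma g -> (forall x, x \in L -> g x = x) -> g = 1.
Proof.
have [[_ _ iso] _] := lattice.
have : isolated Gamma 1 by rewrite iso; case: sGamma.
move=> [_ [U /nbhs_symP [L LU] UG]].
exists L => g Gg gL.
have : (U `&` Gamma) g by split=> //; exact: LU.
by rewrite UG.
Qed.

(** An element of the stabiliser is determined by the images of the finitely
    many vertices of discrete_faithful, each of which has finitely many possible
    values. *)
Lemma finite_vertex_stabiliser v : finite_set (vertex_stabiliser Gamma v).
Proof.
have [L LP] := discrete_faithful; have [G1 GM GV] := sGamma.
have fin (M : seq V) : finite_set [set map g M | g in vertex_stabiliser Gamma v].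
  elim: M => [|x M IH].
    by apply: sub_finite_set (finite_set1 [::]) => _ [g _ <-].
  apply: sub_finite_set (finite_image2 cons (finite_stabiliser_orbit v x) IH).
  move=> _ [g Sg <-]; exists (g x); first by exists g.
  by exists (map g M); first by exists g.
have inj : {in vertex_stabiliser Gamma v &, injective (fun g : Sym V => map g L)}.
  move=> g h /set_mem [Gg _] /set_mem [Gh _] /eq_in_map gh.
  have : h^-1 * g = 1.
    apply: LP; first by apply: GM => //; exact: GV.
    by move=> x xL; rewrite symM_E gh // symK.
  by move=> E; rewrite -[g](mulVKg h) E mulg1.
by rewrite -(eq_finite_set (inj_card_eq inj)).
Qed.

(** Stabilisers of vertices in the same orbit are conjugate. *)
Lemma vertex_stabiliser_bounded :
  exists N, forall v, (card (vertex_stabiliser Gamma v) <= N)%N.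
Proof.
have [s sP] := cocompact_finite_orbits; have [G1 GM GV] := sGamma.
exists (\max_(u <- s) card (vertex_stabiliser Gamma u)) => v.
have [u us [g Gg <-]] := sP v.
suff -> : vertex_stabiliser Gamma (g u) =
    (fun h => g * h * g^-1) @` vertex_stabiliser Gamma u.
  rewrite card_image_inj; last 2 first.
  - exact: finite_vertex_stabiliser.
  - by move=> x y _ _ /mulIg /mulgI.
  exact: (@leq_bigmax_seq _ s xpredT
    (fun u => card (vertex_stabiliser Gamma u)) u us isT).
apply/seteqP; split=> [h [Gh hg]|_ [h [Gh hu] <-]].
  exists (g^-1 * h * g); last by rewrite !mulgA mulgV mul1g mulgK.
  split; last by rewrite !symM_E hg symK.
  by apply: (GM) => //; apply: (GM) => //; exact: GV.
split; last by rewrite !symM_E symK hu.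
by apply: (GM); [exact: GM|exact: GV].
Qed.

(** A subgroup of finite index of Gamma acts freely, so that a smaller one, still
    of finite index, preserves a legal colouring. The colour group is simply
    transitive, so that the finitely many orbits of the subgroup bound its index
    there. *)
Lemma lattice_commensurable_colour_group :
  exists2 n : V -> 'I_d -> V, legal e n & commensurable (colour_group n) Gamma.
Proof.
have [N Nle] := vertex_stabiliser_bounded.
have [H [sH HG fH freeH]] :=
  free_subgroup_exists tree sGamma Gaut finite_vertex_stabiliser Nle.
have Haut : H `<=` graph_aut e by move=> h /HG /Gaut.
have [n ln fHn] := free_periodic_colouring regular d_gt0 sH Haut freeH.
exists n => //; have sW := is_subgroup_colour_group n.
have sHW := is_subgroupI sH sW.
have fHG : finite_index (H `&` colour_group n) Gamma.
  by apply: (finite_index_trans sGamma sH sHW) => // x [].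
have sWG := is_subgroupI sW sGamma.
have HWG : H `&` colour_group n `<=` colour_group n `&` Gamma.
  by move=> x [Hx Wx]; split=> //; exact: HG.
split; last exact: finite_indexS fHG.
apply: (finite_indexS sWG sHW HWG).
have [s sP] := cocompact_finite_orbits; have [[v0] _ _ _ _] := tree.
pose K := H `&` colour_group n.
(* a coset of K is determined by the K-orbit of a vertex, and each of the
   finitely many Gamma-orbits splits into finitely many K-orbits *)
pose pick (x : Sym V) := xget (v0, 1) [set p : V * Sym V |
  [/\ p.1 \in s, Gamma p.2 & p.2 p.1 = x^-1 v0]].
have pickP x : [/\ (pick x).1 \in s, Gamma (pick x).2 & (pick x).2 (pick x).1 = x^-1 v0].
  apply: (@xgetPex _ (v0, 1) [set p : V * Sym V |
    [/\ p.1 \in s, Gamma p.2 & p.2 p.1 = x^-1 v0]]).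
  by have [u us [g Gg gu]] := sP (x^-1 v0); exists (u, g).
have [G1 GM GV] := sGamma; have [W1 WM WV] := sW.
apply: (@finite_index_fun _ _ (fun x => ((pick x).1, left_coset (pick x).2^-1 K))) => //.
  apply: sub_finite_set (finite_setX (finite_seq s) fHG).
  move=> _ [x Wx <-]; have [us Gg _] := pickP x; split=> //=.
  by exists (pick x).2^-1 => //; exact: GV.
move=> x y Wx Wy [uxy] /left_coset_eqP => /(_ sHW); rewrite invgK => Kxy.
have [_ _ px] := pickP x; have [_ _ py] := pickP y.
suff -> : x^-1 * y = (pick x).2 * (pick y).2^-1 by [].
apply: (colour_map_unique regular (legal_labelling ln) (v0 := y^-1 v0)).
- by apply: WM => //; exact: WV.
- by case: Kxy.
by rewrite !symM_E symVK -py symK -uxy px.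
Qed.

End Lattices.
(** * Changing the colours of a finite quotient *)

Section Recolouring.
Local Open Scope group_scope.
Variables (V : choiceType) (e : rel V) (d : nat).
Hypotheses (d_gt0 : (0 < d)%N) (regular : is_regular_tree e d).
Variables (n : V -> 'I_d -> V) (v0 : V).
Hypothesis ln : legal e n.
Local Notation W := (colour_group n).

Let tree : is_tree e. Proof. by case: regular. Qed.
Let i0 : 'I_d := Ordinal d_gt0.

Section Monodromy.
Variables (T : finType) (a : 'I_d -> {perm T}).
Hypothesis a_invol : forall i, a i * a i = 1.

(** The involutions a i define a permutation representation of the colour group
    W, a free product of groups of order two. Since w |-> w v0 identifies W with
    the set of vertices, the representation is given by the function rho that
    multiplies the involutions along the path from v0 to v. *)
Lemma monodromy_exists : exists rho : V -> {perm T},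
  rho v0 = 1 /\ forall v i, rho (n v i) = rho v * a i.
Proof.
have [n1 n2 n3 n4] := ln.
pose theta (v w : V) (s : {perm T}) : {perm T} := (s * a (label n i0 v w))%g.
have [||//|f [_ fs] f0] := @section_exists V e tree _ (fun _ _ => True) theta _ _ v0 1%g.
- by [].
- by move=> v w s vw _; rewrite /theta (label_sym regular i0 ln vw) -mulgA a_invol mulg1.
exists f; split=> // v i.
by rewrite (fs v (n v i)) // /theta (label_n (legal_labelling ln)).
Qed.

Definition monodromy := projT1 (cid monodromy_exists).

Lemma monodromy1 : monodromy v0 = 1.
Proof. by case: (projT2 (cid monodromy_exists)). Qed.

Lemma monodromyM v i : monodromy (n v i) = monodromy v * a i.
Proof. by case: (projT2 (cid monodromy_exists)). Qed.

Definition permutation_rep (w : Sym V) : {perm T} := monodromy (w v0).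

Lemma monodromy_translate w v : W w -> monodromy (w v) = permutation_rep w * monodromy v.
Proof.
move=> Ww; have [_ _ n3 _] := ln.
apply: (tree_ind tree (v0 := v0) (P := fun v => monodromy (w v) = _ * monodromy v)).
  by rewrite monodromy1 mulg1.
move=> u u' /n3 [i <-] IH.
by rewrite Ww !monodromyM IH mulgA.
Qed.

Lemma permutation_rep_hom : hom_on W permutation_rep.
Proof. by move=> x y Wx Wy; rewrite {1}/permutation_rep symM_E monodromy_translate. Qed.

Lemma image_permutation_rep :
  image_grp permutation_rep W = <<finset (fun s => [exists i, s == a i])>>%G.
Proof.
have sW := is_subgroup_colour_group n.
apply: val_inj => /=; rewrite (image_grpE sW permutation_rep_hom).
apply/eqP; rewrite finset.eqEsubset; apply/andP; split; apply/fintype.subsetP => s.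
  move=> /image_inP[w _ <-]; rewrite /permutation_rep; have [_ _ n3 _] := ln.
  apply: (tree_ind tree (v0 := v0) (P := fun v => monodromy v \in _)).
    by rewrite monodromy1 group1.
  move=> u u' /n3 [i <-] IH; rewrite monodromyM groupM // mem_gen // inE.
  by apply/existsP; exists i.
rewrite -(image_grpE sW permutation_rep_hom); apply: fintype.subsetP s.
rewrite gen_subG; apply/fintype.subsetP => s; rewrite inE => /existsP[i /eqP ->].
apply: mem_gen; apply/image_inP.
have [w Ww w0] := colour_map_exists regular v0 (n v0 i) d_gt0 ln ln.
by exists w => //; rewrite /permutation_rep w0 monodromyM monodromy1 mul1g.
Qed.

Definition point_stabiliser y : set (Sym V) := [set w | W w /\ permutation_rep w y = y].

Lemma is_subgroup_point_stabiliser y : is_subgroup (point_stabiliser y).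
Proof.
have [W1 WM WV] := is_subgroup_colour_group n.
have r1 : permutation_rep 1 = 1 by exact: monodromy1.
split.
- by split=> //; rewrite r1 perm1.
- move=> g h [Wg gy] [Wh hy]; split; first exact: WM.
  by rewrite permutation_rep_hom // permM gy hy.
- move=> g [Wg gy]; have Wg' := WV _ Wg; split=> //.
  have : permutation_rep g^-1 (permutation_rep g y) = y.
    by rewrite -permM -permutation_rep_hom // mulgV r1 perm1.
  by rewrite gy.
Qed.

Lemma finite_index_point_stabiliser y : finite_index (point_stabiliser y) W.
Proof.
have [W1 WM WV] := is_subgroup_colour_group n.
apply: (@finite_index_fun _ _ (fun w => permutation_rep w^-1 y)).
- exact: is_subgroup_point_stabiliser.
- exact: finite_finset.
- move=> g h Wg Wh gh; have Wg' := WV _ Wg; have Wh' := WV _ Wh.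
  split; first exact: WM.
  by rewrite permutation_rep_hom // permM gh -permM -permutation_rep_hom // mulVg
    /permutation_rep monodromy1 perm1.
Qed.

Lemma separates_point_stabiliser y : separates W (point_stabiliser y) permutation_rep.
Proof.
split; first exact: permutation_rep_hom.
by move=> w Ww w1; split=> //; rewrite w1 perm1.
Qed.

Lemma image_point_stabiliser y s :
  s \in image_grp permutation_rep (point_stabiliser y) -> s y = y.
Proof.
have hr : hom_on (point_stabiliser y) permutation_rep.
  by apply: hom_onW permutation_rep_hom => w [].
rewrite /= (image_grpE (is_subgroup_point_stabiliser y) hr).
by move=> /image_inP[w [_ wy] <-].
Qed.

End Monodromy.

(** The permutations a and b draw the same graph on T: the edge coloured i at y
    by a is coloured tau y i by b, and the first condition on tau says that the
    two ends of the edge agree on its new colour. The map pi from the tree to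
    this graph is the universal covering with v0 over y0. *)
Section Change.
Variables (T : finType) (y0 : T) (a b : 'I_d -> {perm T}) (tau : T -> {perm 'I_d}).
Hypothesis a_invol : forall i, a i * a i = 1.
Hypothesis b_invol : forall i, b i * b i = 1.
Hypothesis tau_edge : forall y i, tau (a i y) i = tau y i.
Hypothesis b_tau : forall y i, b (tau y i) y = a i y.

Let pi v := monodromy a_invol v y0.
Let pi' v := monodromy b_invol v y0.

Let piM v i : pi (n v i) = a i (pi v).
Proof. by rewrite /pi monodromyM permM. Qed.
Let piM' v i : pi' (n v i) = b i (pi' v).
Proof. by rewrite /pi' monodromyM permM. Qed.

(** The new colouring of the graph, lifted to the tree. *)
Definition recolour v (j : 'I_d) : V := n v ((tau (pi v))^-1 j).

Lemma recolour_tau v i : recolour v (tau (pi v) i) = n v i.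
Proof. by rewrite /recolour permK. Qed.

Lemma legal_recolour : legal e recolour.
Proof.
have [n1 n2 n3 n4] := ln; split=> [v j|v i j|v w vw|v j].
- exact: n1.
- by move=> /n2 /perm_inj.
- by have [i <-] := n3 _ _ vw; exists (tau (pi v) i); exact: recolour_tau.
- rewrite {2}/recolour; set i := (tau (pi v))^-1 j.
  have -> : j = tau (pi (n v i)) i by rewrite piM tau_edge /i permKV.
  by rewrite recolour_tau n4.
Qed.

(** The element g is the isomorphism from the new colouring of the tree to the
    old one. The stabiliser defined by a is the group of the deck
    transformations of pi that preserve the old colouring; they also preserve
    the new one, which g turns into the old one. *)
Lemma recolouring_conjugates : exists g, [/\ graph_aut e g &
  conj_set g (point_stabiliser a_invol y0) = point_stabiliser b_invol y0].
Proof.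
have [g gn gv0] := colour_map_exists regular v0 v0 d_gt0 legal_recolour ln.
have gV0 : g^-1 v0 = v0 by rewrite -{1}gv0 symK.
have [n1 n2 n3 n4] := ln.
have gtau v i : g (n v i) = n (g v) (tau (pi v) i) by rewrite -recolour_tau gn.
have pig v : pi' (g v) = pi v.
  apply: (tree_ind tree (v0 := v0) (P := fun v => pi' (g v) = pi v)).
    by rewrite gv0 /pi /pi' !monodromy1 !perm1.
  by move=> u u' /n3 [i <-] IH; rewrite gtau piM' IH piM b_tau.
have pi_u u v : point_stabiliser a_invol y0 u -> pi (u v) = pi v.
  by move=> [Wu uy]; rewrite /pi monodromy_translate // permM uy.
have pi_h h v : point_stabiliser b_invol y0 h -> pi' (h v) = pi' v.
  by move=> [Wh hy]; rewrite /pi' monodromy_translate // permM hy.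
exists g; split.
  by apply: colour_map_aut gn; apply: legal_labelling; [exact: legal_recolour|exact: ln].
apply/seteqP; split=> h; rewrite conj_setE => Uh.
- have [Wu _] := Uh; split.
    move=> v j; pose v' := g^-1 v; pose i := (tau (pi v'))^-1 j.
    have nv : n v j = g (n v' i) by rewrite gtau permKV symVK.
    have := Wu v' i; rewrite !symM_E -nv => /(canRL (symVK g)) ->.
    have := gtau ((g^-1 * h * g) v') i; rewrite pi_u // permKV !symM_E !symVK => ->.
    by [].
  have := pi_u _ v0 Uh; rewrite !symM_E gv0 -pig symVK /pi monodromy1 perm1.
  by [].
- have [Wh _] := Uh.
  have piu v : pi ((g^-1 * h * g) v) = pi v.
    by rewrite -pig !symM_E symVK pi_h // pig.
  split.
    move=> v i; apply: (can_inj (symK g)).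
    rewrite gtau piu !symM_E !symVK gtau.
    exact: Wh.
  by have := piu v0; rewrite /pi monodromy1 perm1.
Qed.

End Change.

End Recolouring.
(** * Elements with prescribed displacement *)

Section Displacements.
Local Open Scope group_scope.
Variables (V : choiceType) (e : rel V) (d : nat).
Hypotheses (d_ge3 : (2 < d)%N) (regular : is_regular_tree e d).
Variables (n : V -> 'I_d -> V) (v0 : V).
Hypothesis ln : legal e n.
Variable Gamma : set (Sym V).
Hypotheses (sGamma : is_subgroup Gamma) (cWG : commensurable (colour_group n) Gamma).
Local Notation W := (colour_group n).
Local Notation C := (commensurator (graph_aut e) Gamma).

Let d_gt0 : (0 < d)%N. Proof. exact: ltn_trans d_ge3. Qed.
Let sW : is_subgroup W. Proof. exact: is_subgroup_colour_group. Qed.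

(** The displacement may be computed on any group commensurable to Gamma, such
    as the stabiliser defined by a; its conjugate by g is the stabiliser defined
    by b, and both have finite index in W. *)
Lemma recolouring_displacement (T : finType) (y0 : T) (a b : 'I_d -> {perm T})
    (tau : T -> {perm 'I_d}) (a_invol : forall i, a i * a i = 1)
    (b_invol : forall i, b i * b i = 1) :
  (forall y i, tau (a i y) i = tau y i) ->
  (forall y i, b (tau y i) y = a i y) ->
  exists2 g, C g & forall q, prime q -> displacement Gamma q g =
    (refined_index q W (point_stabiliser d_gt0 regular v0 ln b_invol y0) -
     refined_index q W (point_stabiliser d_gt0 regular v0 ln a_invol y0))%R.
Proof.
move=> tau_edge b_tau.
have [g [gaut gU]] := recolouring_conjugates d_gt0 regular v0 ln y0 a_invol b_invol tau_edge b_tau.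
set A := point_stabiliser d_gt0 regular v0 ln a_invol y0 in gU *.
set B := point_stabiliser d_gt0 regular v0 ln b_invol y0 in gU *.
have sA : is_subgroup A by exact: is_subgroup_point_stabiliser.
have sB : is_subgroup B by exact: is_subgroup_point_stabiliser.
have AW : A `<=` W by move=> w [].
have BW : B `<=` W by move=> w [].
have cWA : commensurable W A.
  by apply: finite_index_commensurable => //; exact: finite_index_point_stabiliser.
have cWB : commensurable W B.
  by apply: finite_index_commensurable => //; exact: finite_index_point_stabiliser.
have cAG : commensurable A Gamma.
  exact: commensurable_trans (commensurable_sym cWA) cWG.
have Cg : C g.
  split=> //; have sgG := is_subgroup_conj g sGamma.
  have cBgG : commensurable B (conj_set g Gamma).
    by rewrite -gU; exact: commensurable_conj.
  apply: (commensurable_trans sGamma sB sgG) => //.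
  apply: (commensurable_trans sGamma sW sB) => //; exact: commensurable_sym.
exists g => // q pq.
rewrite (displacement_commensurable sGamma pq Cg sA cAG) gU.
rewrite (index_gap_trans pq sA sW sB (commensurable_sym cWA) cWB).
rewrite index_gap_sym !index_gap_sub //; lia.
Qed.

(** On the integers modulo p, the reflections x |-> 1 - x and x |-> - x draw a
    path with a half-edge at each end; the other colours are half-edges at all
    vertices. The reflection x |-> 1 - x exchanges 0 and 1, and giving the third
    colour to the edge that joins them adds the transposition t of these two
    points to the group. *)
Lemma prime_displacement p : prime p -> (4 < p)%N ->
  exists2 g, C g & displacement Gamma p g = (-1)%R /\
    forall q, prime q -> (p < q)%N -> displacement Gamma q g = 0%R.
Proof.
case: p => [|[|m]] // pp p4.
pose i0 : 'I_d := Ordinal d_gt0.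
pose i1 : 'I_d := Ordinal (ltnW d_ge3); pose i2 : 'I_d := Ordinal d_ge3.
pose r0 := reflection (0%R : 'I_m.+2); pose r1 := reflection (1%R : 'I_m.+2).
pose t : {perm 'I_m.+2} := tperm 0%R 1%R.
pose a (i : 'I_d) : {perm 'I_m.+2} :=
  if i == i0 then r1 else if i == i1 then r0 else 1.
pose b (i : 'I_d) : {perm 'I_m.+2} :=
  if i == i0 then r1 * t else if i == i1 then r0 else if i == i2 then t else 1.
pose first_edge (y : 'I_m.+2) := (y == 0%R) || (y == 1%R).
pose tau y : {perm 'I_d} := if first_edge y then tperm i0 i2 else 1.
have i01 : i0 != i1 by [].
have i02 : i0 != i2 by [].
have i12 : i1 != i2 by [].
have a_invol i : a i * a i = 1.
  by rewrite /a; case: ifP => _; [|case: ifP => _]; rewrite ?reflection_invol ?mulg1.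
have r1E y : first_edge (r1 y) = first_edge y.
  rewrite /first_edge permE GRing.subr_eq0 -[X in _ || X]GRing.subr_eq0.
  by rewrite GRing.addrAC GRing.subrr GRing.add0r GRing.oppr_eq0 orbC (eq_sym 1%R).
have tau_edge y i : tau (a i y) i = tau y i.
  rewrite /a; case: (eqVneq i i0) => [->|ni0]; first by rewrite /tau r1E.
  case: (eqVneq i i1) => [->|ni1]; last by rewrite perm1.
  rewrite /tau; case: ifP => _; case: ifP => _; rewrite ?perm1 ?tpermD //.
have tE y : first_edge y -> t y = r1 y.
  rewrite /first_edge => /orP[] /eqP ->; rewrite [RHS]permE /t.
    by rewrite tpermL GRing.subr0.
  by rewrite tpermR GRing.subrr.
have tD y : ~~ first_edge y -> t y = y.
  by rewrite negb_or => /andP[y0 y1]; rewrite tpermD // eq_sym.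
have r1K y : r1 (r1 y) = y by rewrite -permM reflection_invol perm1.
have b_tau y i : b (tau y i) y = a i y.
  rewrite /tau; case: (boolP (first_edge y)) => fy; last first.
    rewrite perm1 /a /b; case: ifP => _.
      by rewrite permM tD // r1E.
    case: ifP => _ //; case: ifP => _ //; by rewrite tD // perm1.
  case: (eqVneq i i0) => [->|ni0].
    rewrite tpermL /b /a !eqxx /= tE //.
  case: (eqVneq i i2) => [->|ni2].
    rewrite tpermR /b /a !eqxx /= permM tE ?r1E // r1K perm1 //.
  rewrite tpermD 1?eq_sym // /a /b (negbTE ni0) (negbTE ni2) //.
have b_invol i : b i * b i = 1.
  apply/perm.permP => y; rewrite permM perm1.
  pose j := (tau y)^-1 i; have iE : i = tau y j by rewrite /j permKV.
  rewrite {2}iE b_tau {1}iE -(tau_edge y j) b_tau -permM a_invol perm1 //.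
have [g Cg gE] := recolouring_displacement (0%R : 'I_m.+2) a_invol b_invol tau_edge b_tau.
have riE q (c : 'I_d -> {perm 'I_m.+2}) (ci : forall i, c i * c i = 1) : prime q ->
  refined_index q W (point_stabiliser d_gt0 regular v0 ln ci (0%R : 'I_m.+2)) =
  ((pfactors q <<finset (fun s => [exists i, s == c i])>>%G)%:Z -
   (pfactors q (image_grp (permutation_rep d_gt0 regular v0 ln ci)
      (point_stabiliser d_gt0 regular v0 ln ci (0%R : 'I_m.+2))))%:Z)%R.
  move=> pq; rewrite (refined_indexE pq sW _ _ (separates_point_stabiliser d_gt0 regular v0 ln ci _)).
  - by rewrite image_permutation_rep.
  - exact: is_subgroup_point_stabiliser.
  - by move=> w [].
exists g => //; split; last first.
  move=> q pq ltpq; rewrite gE // !riE //.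
  by rewrite !(pfactors_perm_lt _ pq ltpq).
have stab0 c (ci : forall i, c i * c i = 1) :
    pfactors m.+2 (image_grp (permutation_rep d_gt0 regular v0 ln ci)
      (point_stabiliser d_gt0 regular v0 ln ci (0%R : 'I_m.+2))) = 0%N.
  apply: (pfactors_perm_stab pp (x := 0%R)) => s; exact: image_point_stabiliser.
have inc (c : 'I_d -> {perm 'I_m.+2}) i :
    c i \in <<finset (fun s => [exists i, s == c i])>>%G.
  by apply: mem_gen; rewrite inE; apply/existsP; exists i.
rewrite gE // !riE // !stab0 pfactors_Sym //; last 2 first.
- by have := inc b i2.
- have -> : shift m = b i1 * (b i0 * b i2).
    by rewrite /b !eqxx /= -mulgA tperm2 mulg1 -reflectionM.
  by apply: groupM; [exact: inc|apply: groupM; exact: inc].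
rewrite pfactors_dihedral //.
apply/eqP; rewrite finset.eqEsubset !gen_subG; apply/andP; split.
  apply/fintype.subsetP => s; rewrite inE => /existsP[i /eqP ->].
  rewrite /a; case: ifP => _; first by rewrite mem_gen // !inE eqxx orbT.
  by case: ifP => _; [rewrite mem_gen // !inE eqxx|exact: group1].
apply/fintype.subsetP => s /set2P[] ->; last by have := inc a i0; rewrite /a eqxx.
by have := inc a i1; rewrite /a eqxx.
Qed.

End Displacements.
(** * Commensurators of cocompact lattices *)

Theorem corollary4p8 (d : nat) (V : choiceType) (e : rel V)
    (Gamma : set (Sym V)) :
  (3 <= d)%N -> is_regular_tree e d ->
  cocompact_lattice Gamma (graph_aut e) ->
  let C := commensurator (graph_aut e) Gamma in
  (exists N : set (Sym (coset_space C Gamma)),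
     [/\ normal_subgroup N (completion C Gamma),
         open_in (completion C Gamma) N &
         quotient_free_abelian_infinite_rank (completion C Gamma) N]) /\
  ~ virtually_topologically_simple (completion C Gamma).
Proof.
move=> d_ge3 regular lattice C.
have d_gt0 : (0 < d)%N by exact: ltn_trans d_ge3.
have [[sGamma Gaut _] _] := lattice.
have [[v0] _ _ _ _] := regular.1.
have [n ln cWG] := lattice_commensurable_colour_group d_gt0 regular lattice.
have saut : is_subgroup (graph_aut e).
  split=> [//|g h ga ha x y|g ga x y]; first by rewrite !symM_E ga ha.
  by rewrite -ga !symVK.
have sC : is_subgroup C by exact: is_subgroup_commensurator.
have GC : Gamma `<=` C by exact: sub_commensurator.
have prime_of (p : large_prime) : prime (val p) by case: p => p /= /andP[].
have witness (p : large_prime) := prime_displacement d_ge3 regular v0 ln sGamma cWG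
  (prime_of p) (let: conj _ p4 := andP (valP p) in p4).
have coeff_exists g : C g ->
    exists D : {freeg large_prime}, forall p, coeff p D = displacement Gamma (val p) g.
  move=> Cg; have [N NP] := displacement_large sGamma Cg.
  by apply: (@freeg_of_coeff _ N) => p; exact: NP.
pose phi g : {freeg large_prime} :=
  xget 0%R [set D | forall p, coeff p D = displacement Gamma (val p) g].
have phiE g p : C g -> coeff p (phi g) = displacement Gamma (val p) g.
  move=> /coeff_exists ex; move: p.
  exact: (@xgetPex _ 0%R [set D : {freeg large_prime} |
    forall p, coeff p D = displacement Gamma (val p) g]).
have phi_ext g (D : {freeg large_prime}) : C g ->
    (forall p, coeff p D = displacement Gamma (val p) g) -> phi g = D.
  by move=> Cg DE; apply/eqP/freeg_eqP => p; rewrite phiE // DE.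
have phiM x y : C x -> C y -> phi (x * y)%g = (phi x + phi y)%R.
  move=> Cx Cy; have [_ CM _] := sC; apply: phi_ext; first exact: CM.
  by move=> p; rewrite coeffD !phiE // (displacementM sGamma (prime_of p) Cx Cy).
have phiG x : Gamma x -> phi x = 0%R.
  move=> Gx; apply: phi_ext; first exact: GC.
  by move=> p; rewrite coeff0 displacement_base.
split.
  apply: (completion_quotient sC sGamma GC phiM phiG); last exact: large_prime_infinite.
  apply: (triangular_surjective sC phiM) => p; have [g Cg [g1 g0]] := witness p.
  by exists g => //; split=> [|q pq]; rewrite phiE //; exact: g0.
pose p5 : large_prime := exist _ 5%N isT; pose p7 : large_prime := exist _ 7%N isT.
have [g7 C7 [g77 _]] := witness p7; have [g5 C5 [g55 g57]] := witness p5.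
apply: (@completion_not_virtually_simple _ _ _ sC sGamma GC
  (displacement Gamma 7) (displacement Gamma 5) g7 g5) => //.
- by move=> x y; exact: displacementM.
- by move=> x; exact: displacement_base.
- by move=> x y; exact: displacementM.
- by move=> x; exact: displacement_base.
- by rewrite g77.
- exact: g57.
- by rewrite g55.
Qed.
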